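(* Let $X$ be a set and $\Phi\subseteq \mathbf{k}\mathfrak{M}(X)$ a set of multilinear operated polynomial identities (OPIs). Let $A=\mathbf{k}\mathcal{M}(Z)/I_A$ be a unital algebra with generating set $Z$, where $I_A$ is an ideal of $\mathbf{k}\mathcal{M}(Z)$. Let $\le$ be a monomial order on $\mathfrak{M}(Z)$ such that $S_\Phi(Z)$ is an operated GS basis in $\mathbf{k}\mathfrak{M}(Z)$ with respect to $\le$, and let $G$ be a GS basis of $I_A$ in $\mathbf{k}\mathcal{M}(Z)$ with respect to the restriction of $\le$ to $\mathcal{M}(Z)$. Suppose that, for every OPI $\phi=\phi(x_1,\dots,x_n)\in\Phi$ with leading monomial $\overline{\phi}\in\mathfrak{M}(X)$: (i) $\overline{\phi}$ has no subword in $\mathcal{S}(X)\setminus X$; and (ii) for all $u_1,\dots,u_n\in\mathfrak{M}(Z)$, either $\phi(u_1,\dots,u_n)=0$ or the leading monomial of $\phi(u_1,\dots,u_n)$ with respect to $\le$ is $\overline{\phi}(u_1,\dots,u_n)$. Let $\eta:\mathbf{k}\mathfrak{M}(Z)\to \mathcal{F}^{\Phi\text{-}\mathrm{Alg}}_{\mathrm{uAlg}}(A)=\mathbf{k}\mathfrak{M}(Z)/\langle S_\Phi(Z)\cup I_A\rangle_{\mathrm{uOpAlg}}$ be the natural quotient map onto the free $\Phi$-algebra over $A$. Then $\eta(\mathrm{Irr}(S_\Phi(Z)\cup G))$ is a $\mathbf{k}$-basis of $\mathcal{F}^{\Phi\text{-}\mathrm{Alg}}_{\mathrm{uAlg}}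(A)$.
   Context: $\mathbf{k}$ is a field. For a set $Z$, $\mathcal{S}(Z)$ is the free semigroup (nonempty words) and $\mathcal{M}(Z)$ the free monoid on $Z$; $\mathcal{S}(X)\setminus X$ is thus the set of words of length at least $2$ in $X$. A unital operated algebra is a unital $\mathbf{k}$-algebra with a $\mathbf{k}$-linear operator; an operated ideal is a (two-sided) ideal closed under the operator, and $\langle S\rangle_{\mathrm{uOpAlg}}$ is the operated ideal generated by $S$. $\mathfrak{M}(Z)$ is the free operated monoid on $Z$ (monoid with an arbitrary self-map), consisting of bracketed words: $\mathfrak{M}(Z)=\bigcup_n\mathfrak{M}_n$ with $\mathfrak{M}_0=\mathcal{M}(Z)$, $\mathfrak{M}_{n+1}=\mathcal{M}(Z\sqcup\lfloor\mathfrak{M}_n\rfloor)$ and operator $u\mapsto\lfloor u\rfloor$. Its linear span $\mathbf{k}\mathfrak{M}(Z)$ is the free unital operated algebra on $Z$, and $\mathbf{k}\mathcal{M}(Z)\subseteq\mathbf{k}\mathfrak{M}(Z)$. Each $u\ne1$ in $\mathfrak{M}(Z)$ is uniquely a product $u_1\cdots u_n$ with $u_i\in Z\cup\lfloor\mathfrak{M}(Z)\rfloor$; its breadth is $|u|=n$, and $|1|=0$. For a symbol $\star\notin Z$, $\mathfrak{M}^\star(Z)$ is the set of elements of $\mathfrak{M}(Z\cup\{\star\})$ in which $\star$ occurs exactly once; $q|_u$ is obtained from $q\in\mathfrak{M}^\star(Z)$ by replacing $\star$ by $u\in\mathfrak{M}(Z)$, extended linearly to $q|_s$ for $s\in\mathbf{k}\mathfrak{M}(Z)$.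 An element $u$ is a subword of $w$ if $w=q|_u$ for some $q\in\mathfrak{M}^\star(Z)$. A monomial order on $\mathfrak{M}(Z)$ is a well-order $\le$ such that $u<v$ implies $q|_u<q|_v$ for all $q\in\mathfrak{M}^\star(Z)$; a monomial order on $\mathcal{M}(Z)$ is a well-order with $u<v\Rightarrow wuz<wvz$. For $f\in\mathbf{k}\mathfrak{M}(Z)\setminus\mathbf{k}$, the leading monomial $\bar f$ is the largest monomial appearing in $f$; for $f\in\mathbf{k}$, $\bar f=1$. $f$ is monic if its leading coefficient is $1$; nonzero elements are made monic (monicized) by dividing by their leading coefficients. For monic $f,g$: if $w=\bar fu=v\bar g$ with $u,v,w\in\mathfrak{M}(Z)$ and $\max\{|\bar f|,|\bar g|\}<|w|<|\bar f|+|\bar g|$, then $(f,g)^{u,v}_w:=fu-vg$ is an intersection composition; if $w=\bar f=q|_{\bar g}$ with $q\in\mathfrak{M}^\star(Z)$, then $(f,g)^q_w:=f-q|_g$ is an inclusion composition. For $\mathcal{G}\subseteq\mathbf{k}\mathfrak{M}(Z)$ an element $f$ is trivial modulo $(\mathcal{G},w)$ if $f=\sum_i c_iq_i|_{s_i}$ (finite sum) with $c_i\in\mathbf{k}$, $q_i\in\mathfrak{M}^\star(Z)$, $s_i\in\mathcal{G}$, $q_i|_{\bar s_i}<w$. $\mathcal{G}$ is an operated GS (Gröbner–Shirshov) basis in $\mathbf{k}\mathfrak{M}(Z)$ if for all pairs of (monicized) elements of $\mathcal{G}$ every intersection and inclusion composition with respect to $w$ is trivial modulo $(\mathcal{G},w)$.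 GS bases in $\mathbf{k}\mathcal{M}(Z)$, and of its ideals (GS basis generating the ideal), are the usual ones for associative algebras (same definitions inside $\mathcal{M}(Z)$). For $\mathcal{G}\subseteq\mathbf{k}\mathfrak{M}(Z)$, $\mathrm{Irr}(\mathcal{G}):=\mathfrak{M}(Z)\setminus\{q|_{\bar s}\mid s\in\mathcal{G},\ q\in\mathfrak{M}^\star(Z)\}$, where $s$ ranges over the nonzero elements of $\mathcal{G}$. An OPI is an element $\phi=\phi(x_1,\dots,x_n)\in\mathbf{k}\mathfrak{M}(X)$, $n\ge1$, $x_i\in X$; it is multilinear if it is linear in each $x_i$. For elements $r_1,\dots,r_n$ of a unital operated algebra, $\phi(r_1,\dots,r_n)$ denotes the result of substituting $r_i$ for $x_i$ (the operator replacing $\lfloor\ \rfloor$). Put $S_\Phi(Z):=\{\phi(u_1,\dots,u_n)\mid u_1,\dots,u_n\in\mathfrak{M}(Z),\ \phi(x_1,\dots,x_n)\in\Phi\}\subseteq\mathbf{k}\mathfrak{M}(Z)$. The leading monomial $\overline{\phi}\in\mathfrak{M}(X)$ of an OPI $\phi\in\Phi$ is taken with respect to a fixed monomial order on $\mathfrak{M}(X)$. A $\Phi$-algebra is a unital operated algebra $B$ with $\phi(r_1,\dots,r_n)=0$ for all $\phi\in\Phi$ and $r_i\in B$; $\mathcal{F}^{\Phi\text{-}\mathrm{Alg}}_{\mathrm{uAlg}}$ is the left adjoint of the forgetful functor from $\Phi$-algebras to unital algebras. *)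

(* Defs.v *)
From HB Require Import structures.
From mathcomp Require Import all_boot all_order all_algebra.
From mathcomp Require Import boolp classical_sets wochoice finmap monalg.

Set Implicit Arguments.
Unset Strict Implicit.
Unset Printing Implicit Defensive.

Import GRing.Theory.
Import Quotient.

Local Open Scope classical_set_scope.
Local Open Scope ring_scope.
Local Open Scope quotient_scope.

Local Notation "1" := (@mone _) : monom_scope.
Local Notation "x * y" := (mmul x y) : monom_scope.

(* A unital k-algebra is a ring A with a ring morphism from k to the center of
   A.  The zero algebra has to be allowed (the quotients below may be zero),
   which excludes [algType], where 1 != 0; and no structure can inherit from
   both [pzRingType] and [lmodType k] without inheriting from [lalgType k],
   where 1 != 0 as well. *)
HB.mixin Record PzRing_isUAlgebra (k : fieldType) A of GRing.PzRing A := {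
  scal : k -> A;
  scal_zmod_morphism : zmod_morphism scal;
  scal_monoid_morphism : monoid_morphism scal;
  scal_central : forall c x, scal c * x = x * scal c
}.

#[short(type="uAlgType")]
HB.structure Definition UAlgebra (k : fieldType) :=
  {A of GRing.PzRing A & PzRing_isUAlgebra k A}.

HB.mixin Record UAlgebra_isOperated (k : fieldType) A of UAlgebra k A := {
  oper : A -> A;
  oper_zmod_morphism : zmod_morphism oper;
  oper_scal : forall (c : k) x, oper (scal c * x) = scal c * oper x
}.

#[short(type="uOpAlgType")]
HB.structure Definition UOpAlgebra (k : fieldType) :=
  {A of UAlgebra k A & UAlgebra_isOperated k A}.

Section Morphisms.
Variable k : fieldType.

Definition uAlg_morphism (A B : uAlgType k) (f : A -> B) : Prop :=
  [/\ zmod_morphism f, monoid_morphism f & forall c : k, f (scal c) = scal c].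

Definition uOpAlg_morphism (A B : uOpAlgType k) (f : A -> B) : Prop :=
  uAlg_morphism f /\ forall x, f (oper x) = oper (f x).

Definition is_basis (A : uAlgType k) (B : set A) : Prop :=
  (forall v : A, exists (s : seq A) (c : A -> k),
     (forall x, x \in s -> B x) /\ v = \sum_(x <- s) scal (c x) * x)
  /\ (forall (s : seq A) (c : A -> k),
        uniq s -> (forall x, x \in s -> B x) ->
        \sum_(x <- s) scal (c x) * x = 0 -> forall x, x \in s -> c x = 0).

End Morphisms.

Arguments is_basis {k A} B.

(* The ideals of [ring_quotient] are proper; here they need not be. *)

HB.mixin Record isTwoSidedIdeal (A : pzRingType) (I : A -> bool) := {
  idealMl : forall a x : A, x \in I -> a * x \in I;
  idealMr : forall a x : A, x \in I -> x * a \in I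
}.

#[short(type="idealType")]
HB.structure Definition TwoSidedIdeal (A : pzRingType) :=
  {I of GRing.ZmodClosed A I & isTwoSidedIdeal A I}.

HB.mixin Record isOperClosed (k : fieldType) (A : uOpAlgType k)
    (I : A -> bool) := {
  ideal_oper : forall x : A, x \in I -> oper x \in I
}.

#[short(type="opIdealType")]
HB.structure Definition OperatedIdeal (k : fieldType) (A : uOpAlgType k) :=
  {I of TwoSidedIdeal A I & isOperClosed k A I}.

Section GeneratedIdeal.
Variables (A : pzRingType) (S : set A).

Definition ideal_gen_pred : A -> bool := fun x =>
  `[< forall J : idealType A, (forall s, S s -> s \in J) -> x \in J >].

Fact ideal_gen_zmod_closed : zmod_closed ideal_gen_pred.
Proof.
split=> [|x y /asboolP xI /asboolP yI]; apply/asboolP => J SJ.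
  exact: rpred0.
by rewrite rpredB ?xI ?yI.
Qed.
Fact ideal_genMl (a x : A) : x \in ideal_gen_pred -> a * x \in ideal_gen_pred.
Proof. by move=> /asboolP xI; apply/asboolP => J SJ; apply/idealMl/xI. Qed.
Fact ideal_genMr (a x : A) : x \in ideal_gen_pred -> x * a \in ideal_gen_pred.
Proof. by move=> /asboolP xI; apply/asboolP => J SJ; apply/idealMr/xI. Qed.

HB.instance Definition _ :=
  GRing.isZmodClosed.Build A ideal_gen_pred ideal_gen_zmod_closed.
HB.instance Definition _ :=
  isTwoSidedIdeal.Build A ideal_gen_pred ideal_genMl ideal_genMr.

Definition ideal_gen : idealType A :=
  TwoSidedIdeal.clone A ideal_gen_pred _.

End GeneratedIdeal.

Section GeneratedOperatedIdeal.
Variables (k : fieldType) (A : uOpAlgType k) (S : set A).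

Definition opIdeal_gen_pred : A -> bool := fun x =>
  `[< forall J : opIdealType A, (forall s, S s -> s \in J) -> x \in J >].

Fact opIdeal_gen_zmod_closed : zmod_closed opIdeal_gen_pred.
Proof.
split=> [|x y /asboolP xI /asboolP yI]; apply/asboolP => J SJ.
  exact: rpred0.
by rewrite rpredB ?xI ?yI.
Qed.
Fact opIdeal_genMl (a x : A) : x \in opIdeal_gen_pred -> a * x \in opIdeal_gen_pred.
Proof. by move=> /asboolP xI; apply/asboolP => J SJ; apply/idealMl/xI. Qed.
Fact opIdeal_genMr (a x : A) : x \in opIdeal_gen_pred -> x * a \in opIdeal_gen_pred.
Proof. by move=> /asboolP xI; apply/asboolP => J SJ; apply/idealMr/xI. Qed.
Fact opIdeal_gen_oper (x : A) : x \in opIdeal_gen_pred -> oper x \in opIdeal_gen_pred.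
Proof. by move=> /asboolP xI; apply/asboolP => J SJ; apply/ideal_oper/xI. Qed.

HB.instance Definition _ :=
  GRing.isZmodClosed.Build A opIdeal_gen_pred opIdeal_gen_zmod_closed.
HB.instance Definition _ :=
  isTwoSidedIdeal.Build A opIdeal_gen_pred opIdeal_genMl opIdeal_genMr.
HB.instance Definition _ :=
  isOperClosed.Build k A opIdeal_gen_pred opIdeal_gen_oper.

Definition opIdeal_gen : opIdealType A :=
  OperatedIdeal.clone k A opIdeal_gen_pred _.

End GeneratedOperatedIdeal.

(* The additive quotient of [ring_quotient], with the remaining structure
   induced from [A]. *)
Definition quotAlg (A : pzRingType) (I : idealType A) : Type := {quot I}.

Section QuotientRing.
Variables (A : pzRingType) (I : idealType A).
Local Notation Q := (quotAlg I).

HB.instance Definition _ := GRing.Zmodule.copy (quotAlg I) {quot I}.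

Definition quot_pi (x : A) : Q := \pi_{quot I} x.
Definition quot_repr (x : Q) : A := repr (x : {quot I}).

Fact quot_reprK : cancel quot_repr quot_pi.
Proof. exact: reprK. Qed.

Fact quot_piP (x y : A) : reflect (quot_pi x = quot_pi y) (x - y \in I).
Proof. by rewrite idealrBE; apply: eqP. Qed.

Fact ideal_quot_repr (x : A) : quot_repr (quot_pi x) - x \in I.
Proof. by apply/quot_piP; rewrite quot_reprK. Qed.

Fact quot_pi_zmod_morphism : zmod_morphism quot_pi.
Proof. by move=> x y; rewrite /quot_pi !piE. Qed.

HB.instance Definition _ :=
  GRing.isZmodMorphism.Build A Q quot_pi quot_pi_zmod_morphism.

Fact quot_piW (P : Q -> Prop) : (forall x, P (quot_pi x)) -> forall x, P x.
Proof. by move=> Pp x; rewrite -[x]quot_reprK. Qed.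

Definition quot_mul (x y : Q) : Q := quot_pi (quot_repr x * quot_repr y).

Fact quot_mulE (x y : A) : quot_mul (quot_pi x) (quot_pi y) = quot_pi (x * y).
Proof.
apply/quot_piP; rewrite -[X in X - _](subrK (x * quot_repr (quot_pi y))) -mulrBl.
rewrite -addrA -mulrBr rpredD //; first exact/idealMr/ideal_quot_repr.
exact/idealMl/ideal_quot_repr.
Qed.

Fact quot_mulA : associative quot_mul.
Proof.
elim/quot_piW=> x; elim/quot_piW=> y; elim/quot_piW=> z.
by rewrite (quot_mulE x y) (quot_mulE y z) (quot_mulE x) quot_mulE mulrA.
Qed.
Fact quot_mul1 : left_id (quot_pi 1) quot_mul.
Proof. by elim/quot_piW=> x; rewrite (quot_mulE 1 x) mul1r. Qed.
Fact quot_mulr1 : right_id (quot_pi 1) quot_mul.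
Proof. by elim/quot_piW=> x; rewrite (quot_mulE x 1) mulr1. Qed.
Fact quot_mulDl : left_distributive quot_mul +%R.
Proof.
elim/quot_piW=> x; elim/quot_piW=> y; elim/quot_piW=> z.
rewrite -raddfD (quot_mulE x z) (quot_mulE y z) (quot_mulE _ z).
by rewrite -raddfD mulrDl.
Qed.
Fact quot_mulDr : right_distributive quot_mul +%R.
Proof.
elim/quot_piW=> x; elim/quot_piW=> y; elim/quot_piW=> z.
rewrite -raddfD (quot_mulE x y) (quot_mulE x z) (quot_mulE x).
by rewrite -raddfD mulrDr.
Qed.

HB.instance Definition _ := GRing.Zmodule_isPzRing.Build Q
  quot_mulA quot_mul1 quot_mulr1 quot_mulDl quot_mulDr.

Fact quot_pi_monoid_morphism : monoid_morphism quot_pi.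
Proof. by split=> [|x y] //; rewrite -quot_mulE. Qed.

HB.instance Definition _ :=
  GRing.isMonoidMorphism.Build A Q quot_pi quot_pi_monoid_morphism.

End QuotientRing.

Section QuotientAlgebra.
Variables (k : fieldType) (A : uAlgType k) (I : idealType A).
Local Notation Q := (quotAlg I).

Definition quot_scal (c : k) : Q := quot_pi I (scal c).

Fact quot_scal_zmod_morphism : zmod_morphism quot_scal.
Proof. by move=> a b; rewrite /quot_scal scal_zmod_morphism raddfB. Qed.
Fact quot_scal_monoid_morphism : monoid_morphism quot_scal.
Proof.
have [s1 sM] := @scal_monoid_morphism k A.
by split=> [|a b]; rewrite /quot_scal ?s1 ?sM ?rmorph1 ?rmorphM.
Qed.
Fact quot_scal_central c x : quot_scal c * x = x * quot_scal c.
Proof. by elim/quot_piW: x => x; rewrite -!rmorphM scal_central. Qed.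

HB.instance Definition _ := PzRing_isUAlgebra.Build k Q
  quot_scal_zmod_morphism quot_scal_monoid_morphism quot_scal_central.

End QuotientAlgebra.

Section QuotientOperatedAlgebra.
Variables (k : fieldType) (A : uOpAlgType k) (I : opIdealType A).
Local Notation Q := (quotAlg I).

Definition quot_oper (x : Q) : Q := quot_pi I (oper (quot_repr x)).

Fact quot_operE (x : A) : quot_oper (quot_pi I x) = quot_pi I (oper x).
Proof.
by apply/quot_piP; rewrite -oper_zmod_morphism; apply/ideal_oper/ideal_quot_repr.
Qed.
Fact quot_oper_zmod_morphism : zmod_morphism quot_oper.
Proof.
elim/quot_piW=> x; elim/quot_piW=> y; rewrite -raddfB !quot_operE -raddfB.
by rewrite oper_zmod_morphism.
Qed.
Fact quot_oper_scal (c : k) x : quot_oper (scal c * x) = scal c * quot_oper x.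
Proof.
elim/quot_piW: x => x.
have scalE y : scal c * quot_pi I y = quot_pi I (scal c * y) by rewrite rmorphM.
rewrite (scalE x) (quot_operE x) (quot_operE (scal c * x)) (scalE (oper x)).
by rewrite oper_scal.
Qed.

HB.instance Definition _ := UAlgebra_isOperated.Build k Q
  quot_oper_zmod_morphism quot_oper_scal.

End QuotientOperatedAlgebra.

(* The letters over Z are the elements of Z and the bracketed words, so that
   the free operated monoid is the free monoid on the letters. *)

Inductive letter (Z : Type) : Type :=
| Var of Z
| Br of seq (letter Z).

Section LetterChoice.
Variable Z : choiceType.

Fixpoint letter_encode (l : letter Z) : GenTree.tree Z :=
  match l with
  | Var z => GenTree.Leaf z
  | Br s => GenTree.Node 0 (map letter_encode s)
  end.

Fixpoint letter_decode (t : GenTree.tree Z) : letter Z :=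
  match t with
  | GenTree.Leaf z => Var z
  | GenTree.Node _ s => Br (map letter_decode s)
  end.

Fact letter_encodeK : cancel letter_encode letter_decode.
Proof.
rewrite /cancel; fix IH 1; case=> [z|s]; first exact: erefl.
congr Br; elim: s => [|l s IHs]; first exact: erefl.
exact: congr2 (IH l) IHs.
Qed.

HB.instance Definition _ := Choice.copy (letter Z) (can_type letter_encodeK).

End LetterChoice.

Notation "{ 'bword' Z }" := {fmonom (letter Z)}
  (at level 0, Z at level 2, format "{ 'bword'  Z }") : type_scope.

Notation breadth := fdeg (only parsing).

Definition bracket (Z : choiceType) (w : {bword Z}) : {bword Z} :=
  FMonom [:: Br w].

Definition word_bword (Z : choiceType) (w : {fmonom Z}) : {bword Z} :=
  FMonom (map (@Var Z) w).

Fixpoint letter_occ (Z : eqType) (z : Z) (l : letter Z) : nat :=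
  match l with
  | Var y => (y == z)
  | Br s => sumn (map (letter_occ z) s)
  end.

Definition occ (Z : choiceType) (z : Z) (w : {bword Z}) : nat :=
  (\sum_(l <- w) letter_occ z l)%N.

Fixpoint letter_subst (Y Z : Type) (f : Y -> seq (letter Z)) (l : letter Y) :
    seq (letter Z) :=
  match l with
  | Var y => f y
  | Br s => [:: Br (flatten (map (letter_subst f) s))]
  end.

Definition bsubst (Y Z : choiceType) (f : Y -> {bword Z}) (w : {bword Y}) :
    {bword Z} :=
  FMonom (flatten (map (letter_subst (fun y => f y : seq _)) w)).

(* Bracketed words on Z with one occurrence of the symbol [None]. *)
Definition starword (Z : choiceType) : Type :=
  {q : {bword option Z} | occ None q == 1%N}.

Definition bplug (Z : choiceType) (q : starword Z) (u : {bword Z}) :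
    {bword Z} :=
  bsubst (fun y => if y is Some z then FMonom [:: Var z] else u) (val q).

Definition subword (Z : choiceType) (u w : {bword Z}) : Prop :=
  exists q : starword Z, w = bplug q u.

(* In the free monoid, the words with one occurrence of the star are the pairs
   of words. *)
Definition wplug (Z : choiceType) (q : {fmonom Z} * {fmonom Z})
    (u : {fmonom Z}) : {fmonom Z} :=
  (q.1 * u * q.2)%M.

Definition malg_lift (k : fieldType) (K L : choiceType) (f : K -> L)
    (g : {malg k[K]}) : {malg k[L]} :=
  \sum_(m <- msupp g) << g@_m *g f m >>.

(* Groebner-Shirshov bases in the algebra of a free monoid, with respect to
   the substitutions u |-> q|_u given by [plug]: [bplug] in the operated case,
   [wplug] in the associative case. *)
Section GroebnerShirshov.
Variables (k : fieldType) (L : choiceType).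
Local Notation M := {fmonom L}.
Variables (C : Type) (plug : C -> M -> M) (le : rel M).
Local Notation lt u v := (le u v && (u != v)).
Implicit Types (f g s : {malg k[M]}) (S : set {malg k[M]}).

Definition monomial_order : Prop :=
  well_order le /\ forall q u v, lt u v -> lt (plug q u) (plug q v).

Definition lead f : M :=
  if (msupp f : seq M) is m :: r
  then foldr (fun u v => if le u v then v else u) m r
  else 1%M.

Definition monicize f : {malg k[M]} := (f@_(lead f))^-1 *: f.

Definition trivial_mod S (w : M) f : Prop :=
  exists (n : nat) (c : 'I_n -> k) (q : 'I_n -> C) (s : 'I_n -> {malg k[M]}),
    (forall i, S (s i) /\ lt (plug (q i) (lead (s i))) w)
    /\ f = \sum_i c i *: malg_lift (plug (q i)) (s i).

Definition inter_trivial S f g : Prop :=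
  forall u v w : M, w = (lead f * u)%M -> w = (v * lead g)%M ->
    (maxn (breadth (lead f)) (breadth (lead g)) < breadth w
       < breadth (lead f) + breadth (lead g))%N ->
    trivial_mod S w (f * << u >> - << v >> * g).

Definition incl_trivial S f g : Prop :=
  forall q : C, lead f = plug q (lead g) ->
    trivial_mod S (lead f) (f - malg_lift (plug q) g).

Definition GS_basis S : Prop :=
  forall f g, S f -> f != 0 -> S g -> g != 0 ->
    inter_trivial S (monicize f) (monicize g)
    /\ incl_trivial S (monicize f) (monicize g).

Definition Irr S : set M :=
  [set w | ~ exists s q, [/\ S s, s != 0 & w = plug q (lead s)]].

End GroebnerShirshov.

Definition GS_basis_of_ideal (k : fieldType) (Z : choiceType)
    (le : rel {fmonom Z}) (I : idealType {malg k[{fmonom Z}]})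
    (G : set {malg k[{fmonom Z}]}) : Prop :=
  GS_basis (@wplug Z) le G /\ forall x, (x \in I) = (x \in ideal_gen G).

Section MalgAlgebra.
Variables (k : fieldType) (K : monomType).

Fact malg_scal_central (c : k) (g : {malg k[K]}) : c%:MP * g = g * c%:MP.
Proof.
rewrite mul_malgC [g in RHS]monalgE mulr_suml [g in LHS]monalgE scaler_sumr.
apply: eq_bigr => m _; rewrite -mul_malgC !malgM_def !fgmulUU.
by rewrite mul1m mulm1 mulrC.
Qed.
Fact malg_scal_zmod_morphism : zmod_morphism (@malgC K k).
Proof. by move=> a b; rewrite raddfB. Qed.
Fact malg_scal_monoid_morphism : monoid_morphism (@malgC K k).
Proof. by split=> [|a b]; rewrite ?rmorph1 ?rmorphM. Qed.

HB.instance Definition _ := PzRing_isUAlgebra.Build k {malg k[K]}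
  malg_scal_zmod_morphism malg_scal_monoid_morphism malg_scal_central.

End MalgAlgebra.

Section FreeOperatedAlgebra.
Variables (k : fieldType) (Z : choiceType).
Local Notation kMZ := {malg k[{bword Z}]}.

Definition malg_bracket : kMZ -> kMZ := malg_lift (@bracket Z).

Fact malg_liftEw (K L : choiceType) (f : K -> L) (g : {malg k[K]})
    (d : {fset K}) : fsubset (msupp g) d ->
  malg_lift f g = \sum_(m <- d) << g@_m *g f m >>.
Proof.
move=> sgd; rewrite /malg_lift (big_fset_incl _ sgd) //= => m _.
by move=> /mcoeff_outdom ->; rewrite monalgU0.
Qed.

Fact malg_lift_zmod_morphism (K L : choiceType) (f : K -> L) :
  zmod_morphism (malg_lift (k := k) f).
Proof.
move=> g h; pose d := (msupp g `|` msupp h)%fset.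
rewrite !(@malg_liftEw _ _ _ _ d) ?fsubsetUl ?fsubsetUr ?msuppB_le //.
by rewrite -sumrB; apply: eq_bigr => m _; rewrite mcoeffB monalgUB.
Qed.

Fact malg_bracket_scal (c : k) g :
  malg_bracket (scal c * g) = scal c * malg_bracket g.
Proof.
rewrite /scal /= !mul_malgC /malg_bracket (@malg_liftEw _ _ _ _ (msupp g)).
  rewrite scaler_sumr; apply: eq_bigr => m _.
  by rewrite mcoeffZ -[RHS]mul_malgC malgM_def fgmulUU mul1m.
exact: msuppZ_le.
Qed.

HB.instance Definition _ := UAlgebra_isOperated.Build k kMZ
  (malg_lift_zmod_morphism (@bracket Z)) malg_bracket_scal.

End FreeOperatedAlgebra.

Section OPI.
Variables (k : fieldType) (X : choiceType).
Local Notation kMX := {malg k[{bword X}]}.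

(* A multilinear OPI phi(x_1,...,x_n) with n >= 1: each x_i occurs once in each
   monomial of phi, and no other element of X does. *)
Definition multilinear_OPI (phi : kMX) : Prop :=
  exists xs : seq X, [/\ (0 < size xs)%N, uniq xs &
    forall m, m \in msupp phi -> forall x, occ x m = (x \in xs)].

Fixpoint letter_eval (B : uOpAlgType k) (r : X -> B) (l : letter X) : B :=
  match l with
  | Var x => r x
  | Br s => oper (foldr (fun l b => letter_eval r l * b) 1 s)
  end.

Definition word_eval (B : uOpAlgType k) (r : X -> B) (w : {bword X}) : B :=
  \prod_(l <- w) letter_eval r l.

(* phi(r_1,...,r_n) where r_i is the value of [r] at x_i; the values of [r] at
   the variables that do not occur in phi are irrelevant. *)
Definition OPI_eval (B : uOpAlgType k) (phi : kMX) (r : X -> B) : B :=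
  \sum_(m <- msupp phi) scal phi@_m * word_eval r m.

Definition OPI_words (Z : choiceType) (phi : kMX) (u : X -> {bword Z}) :
    {malg k[{bword Z}]} :=
  OPI_eval phi (fun x => << u x >>).

Definition OPI_instances (Phi : set kMX) (Z : choiceType) : set {malg k[{bword Z}]} :=
  [set f | exists phi u, Phi phi /\ f = OPI_words phi u].

Definition Phi_algebra (Phi : set kMX) (B : uOpAlgType k) : Prop :=
  forall phi, Phi phi -> forall r : X -> B, OPI_eval phi r = 0.

(* F with j : A -> F is the value at A (with the unit of the adjunction) of the
   left adjoint of the forgetful functor from Phi-algebras to unital
   algebras. *)
Definition free_Phi_algebra_over (Phi : set kMX) (A : uAlgType k)
    (F : uOpAlgType k) (j : A -> F) : Prop :=
  [/\ Phi_algebra Phi F, uAlg_morphism j &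
    forall B : uOpAlgType k, Phi_algebra Phi B ->
    forall f : A -> B, uAlg_morphism f ->
    exists! h : F -> B, uOpAlg_morphism h /\ h \o j = f].

End OPI.

Arguments OPI_instances {k X} Phi Z _.

(* Main.v *)
Require Import Defs.
From HB Require Import structures.
From mathcomp Require Import all_boot all_order all_algebra.
From mathcomp Require Import boolp classical_sets wochoice finmap monalg zify.

Set Implicit Arguments.
Unset Strict Implicit.
Unset Printing Implicit Defensive.

Import GRing.Theory.

Local Open Scope classical_set_scope.
Local Open Scope ring_scope.

(** The operated ideal generated by the instances of [Phi] and by [IA] is the span
    of the elements [q|_s], where [s] is an instance of [Phi] or an element of [G].
    The theorem says that the leading words of its elements are exactly the words
    [q|_(lead s)]: then the irreducible words span the quotient by rewriting, and
    no nonzero combination of them lies in the ideal. By the diamond lemma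
    ([diamond]), it is enough that two elements [q|_s] and [q'|_s'] with the same
    leading word [w] differ, once made monic, by a combination of elements [q|_s]
    with leading words below [w].

    When [s] and [s'] are both instances of [Phi], or both in [G], this is the
    Groebner-Shirshov property ([GS_confluent]); for [G] it has to be carried from
    words to bracketed words ([GS_basis_incl]). Because of these two cases, for an
    instance [s] and an element [s'] of [G] it suffices to exhibit one resolved
    pair with the same [w] ([union_confluent], [mixed_resolved]).

    The leading word of an element of [G] has no brackets, and the leading monomial
    of an identity has no two adjacent variables. So if the occurrences of the two
    leading words in [w] are not disjoint, the bracket-free word meets the value of
    a single variable [x] of the identity ([locate]). Where it exceeds this value,
    it does so at an end of the instance, and the missing letters can be moved into
    the value of [x]. One is left with an instance in which the leading word of
    [s'] is a subword of the value of [x], that is, with [phi(.., p|_(lead s'), ..)].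
    Multilinearity then gives the relation: substituting [p|_s'] for [x] produces
    on the one hand a combination of instances of [phi], on the other hand a sum of
    elements [q|_s'], one for each monomial of [phi] ([nested_resolved]).

    Two points need care, both due to monomials of [phi] that take equal values.
    Terms of this sum may exceed [w] and cancel; the part below [w] is bounded by
    the diamond lemma for [G] alone. And the instance obtained by changing the value
    of [x] may vanish. But then the leading word of [s'] occurs in the value of
    another variable of the original instance: otherwise its occurrences determine
    the position of the value of [x], so that the coefficient of the leading word is
    the same as for a generic value of [x], and it is not zero there
    ([instance_neq0], [generic_instance]).

    Occurrences of bracketed words are handled on strings in which the brackets are
    characters: bracketed words are the balanced strings, and words with a star are
    the pairs of strings that surround the star.

    The universal property holds because, by multilinearity, the ideal contains the
    values of the identities at all elements and not only at words
    ([OPI_eval_mem]), and because evaluation of bracketed words is the universal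
    morphism out of the free operated algebra. *)


(** * Bracketed words as balanced strings *)

Section Strings.
Implicit Types (Y Z : Type).

(** The induction principle that Rocq derives for [letter] gives no hypothesis for
    the list under a bracket. *)
Lemma letters_ind Z (P : seq (letter Z) -> Prop) :
  P [::] -> (forall z w, P w -> P (Var z :: w)) ->
  (forall v w, P v -> P w -> P (Br v :: w)) -> forall w, P w.
Proof.
move=> P0 PV PB; pose Q l := if l is Br s then P s else True.
have Qs s : foldr (fun l R => Q l /\ R) True s -> P s.
  elim: s => //= -[z|v] s IHs [Ql /IHs Ps]; [exact: PV | exact: PB].
suff Ql l : Q l by move=> w; apply: Qs; elim: w => //= l w; split.
move: l; fix IH 1; case=> [z|s]; [exact: I | apply: Qs].
by elim: s => [|l s IHs]; [exact: I | exact: conj (IH l) IHs].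
Qed.

(** Brackets become the characters [inr true] (opening) and [inr false] (closing).
    In the resulting strings, the occurrences of a bracketed word are plain
    factors, whatever their depth: they are compared by their positions. *)
Fixpoint letter_string Z (l : letter Z) : seq (Z + bool) :=
  match l with
  | Var z => [:: inl z]
  | Br s => inr true :: rcons (flatten (map (@letter_string Z) s)) (inr false)
  end.

Definition string Z (w : seq (letter Z)) : seq (Z + bool) :=
  flatten (map (@letter_string Z) w).

Lemma string_cons Z (l : letter Z) w :
  string (l :: w) = letter_string l ++ string w.
Proof. by []. Qed.

Lemma string_var_cons Z z (w : seq (letter Z)) : string (Var z :: w) = inl z :: string w.
Proof. by []. Qed.

Lemma string_br Z (v w : seq (letter Z)) :
  string (Br v :: w) = inr true :: string v ++ inr false :: string w.
Proof. by rewrite string_cons /= cat_rcons. Qed.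

Lemma string_cat Z (v w : seq (letter Z)) :
  string (v ++ w) = string v ++ string w.
Proof. by rewrite /string map_cat flatten_cat. Qed.

Lemma string_var Z (z : seq Z) : string (map (@Var Z) z) = map inl z.
Proof. by elim: z => //= z s IHs; rewrite string_cons IHs. Qed.

(** The depth reached from depth [n]; [None] records a closing bracket without a
    partner. *)
Fixpoint depth Z n (s : seq (Z + bool)) : option nat :=
  match s with
  | [::] => Some n
  | inl _ :: t => depth n t
  | inr true :: t => depth n.+1 t
  | inr false :: t => if n is m.+1 then depth m t else None
  end.

Definition balanced Z (s : seq (Z + bool)) : Prop := depth 0 s = Some 0%N.

Lemma depth_cat Z n (s t : seq (Z + bool)) :
  depth n (s ++ t) = obind (fun m => depth m t) (depth n s).
Proof. by elim: s n => //= -[z|[]] s IHs [|n]. Qed.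

Lemma depth_add Z n m j (s : seq (Z + bool)) :
  depth n s = Some m -> depth (n + j) s = Some (m + j)%N.
Proof.
elim: s n => [|[z|[]] s IHs] n /=; first by case=> ->.
- exact: IHs.
- by move=> /IHs; rewrite addSn.
- by case: n => // n /IHs; rewrite addSn.
Qed.

Lemma string_depth Z n (w : seq (letter Z)) : depth n (string w) = Some n.
Proof.
elim/letters_ind: w n => // v w IHv IHw n.
by rewrite string_br /= depth_cat IHv /= IHw.
Qed.

Lemma string_balanced Z (w : seq (letter Z)) : balanced (string w).
Proof. exact: string_depth. Qed.

(** The induction needs the strings that start at a depth [n] and end at depth 0:
    such a string is a word followed by [n] closing brackets, each of them
    followed by a word. *)
Lemma balanced_string Z (s : seq (Z + bool)) :
  balanced s -> exists w, s = string w.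
Proof.
suff : forall n, depth n s = Some 0%N -> exists (w : seq (letter Z)) ws,
    size ws = n /\ s = string w ++ flatten [seq inr false :: string v | v <- ws].
  by move=> /[apply] -[w [[|v ws] [//= _ ->]]]; exists w; rewrite cats0.
elim: s => [|[z|[]] s IHs] n /=.
- by case=> ->; exists [::], [::].
- by move=> /IHs[w [ws [<- ->]]]; exists (Var z :: w), ws.
- move=> /IHs[w [[|v ws] [//= [<-] ->]]]; exists (Br w :: v), ws.
  by rewrite string_br /= -catA.
- by case: n => // n /IHs[w [ws [<- ->]]]; exists [::], (w :: ws).
Qed.

Lemma string_inj Z : injective (@string Z).
Proof.
(* What follows a complete word at the same depth is nothing or the end of the
   enclosing bracket; with this the word is determined as a prefix. *)
pose stop (t : seq (Z + bool)) := if t is c :: _ then c = inr false else True.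
suff H : forall (v w : seq (letter Z)) s t, stop s -> stop t ->
    string v ++ s = string w ++ t -> v = w /\ s = t.
  move=> v w vw; suff [] : v = w /\ [::] = [::] :> seq (Z + bool) by [].
  by apply: H; rewrite // vw.
move=> v; elim/letters_ind: v => [|z v IHv|u v IHu IHv] [|[y|x] w] s t ps pt //;
  rewrite ?string_br ?string_var_cons ?cat0s ?cat_cons; try by move=> st; move: ps; rewrite st.
- by move=> st; move: pt; rewrite -st.
- by case=> <- /IHv[]// -> ->.
- by move=> st; move: pt; rewrite -st.
- case; rewrite -!catA => /IHu[]// -> [] vw.
  by have [-> ->] := IHv w s t ps pt vw.
Qed.

Lemma balanced_insert Z (L s R : seq (Z + bool)) :
  balanced s -> balanced (L ++ s ++ R) <-> balanced (L ++ R).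
Proof.
rewrite /balanced !depth_cat => bs; case: (depth 0 L) => //= n.
by rewrite depth_cat -[n]add0n (depth_add n bs).
Qed.

(** Two overlapping bracketed words overlap in a bracketed word: as the end of a
    balanced string, [T] brings the depth down to 0, and as the beginning of
    another one it never goes below the depth at which it starts. *)
Lemma balanced_overlap Z (P T Q : seq (Z + bool)) :
  balanced (P ++ T) -> balanced (T ++ Q) ->
  [/\ balanced P, balanced T & balanced Q].
Proof.
rewrite /balanced !depth_cat.
case P0 : (depth 0 P) => [n|//] /= Tn; case T0 : (depth 0 T) => [m|//] /= Qm.
move: Tn; rewrite -[n]add0n (depth_add n T0) => -[] /eqP.
rewrite addn_eq0 => /andP[/eqP m0 /eqP n0].
by subst m n; split.
Qed.

Definition char_subst Y Z (f : Y -> seq (Z + bool)) (c : Y + bool) :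
  seq (Z + bool) := match c with inl y => f y | inr b => [:: inr b] end.

Definition string_subst Y Z (f : Y -> seq (Z + bool)) s := flatten (map (char_subst f) s).

Lemma string_subst_cat Y Z (f : Y -> seq (Z + bool)) s t :
  string_subst f (s ++ t) = string_subst f s ++ string_subst f t.
Proof. by rewrite /string_subst map_cat flatten_cat. Qed.

Lemma string_subst_cons Y Z (f : Y -> seq (Z + bool)) c s :
  string_subst f (c :: s) = char_subst f c ++ string_subst f s.
Proof. by []. Qed.

Lemma string_letter_subst Y Z (f : Y -> seq (letter Z)) w :
  string (flatten (map (letter_subst f) w)) =
  string_subst (fun y => string (f y)) (string w).
Proof.
elim/letters_ind: w => [//|y w IHw|v w IHv IHw].
  by rewrite string_cat IHw.
rewrite [flatten _]/= !string_br string_subst_cons string_subst_cat.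
by rewrite string_subst_cons IHv IHw.
Qed.

Lemma string_letter_occ (Z : eqType) (z : Z) (w : seq (letter Z)) :
  (\sum_(l <- w) letter_occ z l)%N = count_mem (inl z) (string w).
Proof.
elim/letters_ind: w => [|y w IHw|v w IHv IHw]; first by rewrite big_nil.
  by rewrite big_cons IHw.
rewrite big_cons IHw string_br /= count_cat /= -IHv.
by rewrite sumnE big_map.
Qed.

End Strings.

(** * Words with a star as pairs of strings *)

Section Contexts.
Variable Z : choiceType.
Implicit Types (v w : {bword Z}) (q : starword Z) (L R : seq (Z + bool)).

Lemma bword_inj (Y : choiceType) (v w : {bword Y}) : string v = string w -> v = w.
Proof. by move=> /string_inj vw; apply: val_inj. Qed.

Lemma string_mul (Y : choiceType) (v w : {bword Y}) :
  string (mmul v w) = string v ++ string w.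
Proof. by rewrite /mmul /= fmmulE string_cat. Qed.

Lemma string_bsubst (X Y : choiceType) (f : X -> {bword Y}) (w : {bword X}) :
  string (bsubst f w) = string_subst (fun x => string (f x)) (string w).
Proof. exact: string_letter_subst. Qed.

Lemma occE (Y : choiceType) (y : Y) (w : {bword Y}) :
  occ y w = count_mem (inl y) (string w).
Proof. exact: string_letter_occ. Qed.

(** The star of [q] is a single character of its string; [L] and [R] are what
    surrounds it. *)
Definition context q L R : Prop :=
  forall v, string (bplug q v) = L ++ string v ++ R.

Lemma context_balanced q L R : context q L R -> balanced (L ++ R).
Proof.
move=> /(_ (FMonom [::])) /= qLR.
by rewrite /balanced -qLR; apply: string_balanced.
Qed.

Lemma eq_in_string_subst (X Y : eqType) (f g : X -> seq (Y + bool)) s :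
  (forall x, inl x \in s -> f x = g x) -> string_subst f s = string_subst g s.
Proof.
elim: s => // c s IHs fg; rewrite !string_subst_cons IHs; last first.
  by move=> x xs; apply: fg; rewrite in_cons xs orbT.
by case: c fg => //= x fg; rewrite fg ?mem_head.
Qed.

Definition some_char (c : Z + bool) : option Z + bool :=
  match c with inl z => inl (Some z) | inr b => inr b end.

Lemma depth_some n s : depth n (map some_char s) = depth n s.
Proof. by elim: s n => //= -[z|[]] s IHs [|n] /=. Qed.

Lemma count_some s : count_mem (inl None) (map some_char s) = 0%N.
Proof. by elim: s => //= -[z|b] s ->. Qed.

Lemma string_subst_some (f : option Z -> seq (Z + bool)) s :
  (forall z, f (Some z) = [:: inl z]) -> string_subst f (map some_char s) = s.
Proof.
by move=> fE; elim: s => //= -[z|b] s IHs; rewrite string_subst_cons IHs //= fE.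
Qed.

Lemma context_ex q : exists L R, context q L R.
Proof.
case: q => w ow; have : inl None \in string w.
  by rewrite -has_pred1 has_count -occE (eqP ow).
case/splitPr sw : _ / => [s t].
pose sub := string_subst (fun y : option Z => if y is Some z then [:: inl z] else [::]).
exists (sub s), (sub t) => v; rewrite string_bsubst /= sw.
have := eqP ow; rewrite occE sw count_cat /= => /eqP.
rewrite addnS eqSS addn_eq0 => /andP[s0 t0].
rewrite string_subst_cat string_subst_cons /=.
by congr (_ ++ (_ ++ _)); apply: eq_in_string_subst => -[z|] //;
  rewrite -has_pred1 has_count ?(eqP s0) ?(eqP t0).
Qed.

(** With [context_ex]: every pair of strings that surrounds a balanced string in a
    balanced string comes from a word with a star. *)
Lemma context_of L R : balanced (L ++ R) -> exists q, context q L R.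
Proof.
rewrite /balanced -depth_some map_cat => bLR.
have : balanced (map some_char L ++ [:: inl None] ++ map some_char R).
  exact/balanced_insert.
case/balanced_string=> w sw.
have ow : occ None (FMonom w) == 1%N.
  by rewrite occE /= -sw !count_cat /= !count_some.
exists (exist (fun x : {bword option Z} => occ None x == 1%N) _ ow) => v.
rewrite string_bsubst /= -sw.
by rewrite !string_subst_cat string_subst_cons /= !string_subst_some // cats0.
Qed.

(** A context is determined by one of its values and the position of its star. *)
Lemma context_size_inj q q' L R L' R' v : context q L R -> context q' L' R' ->
  size L = size L' -> bplug q v = bplug q' v -> bplug q =1 bplug q'.
Proof.
move=> qLR qLR' sL /(congr1 (fun w : {bword Z} => string w)).
rewrite qLR qLR' => /eqP; rewrite eqseq_cat // eqseq_cat //.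
move=> /and3P[/eqP LL _ /eqP RR] u.
by apply: bword_inj; rewrite qLR qLR' LL RR.
Qed.

Lemma context_comp q q' : exists q'', bplug q'' =1 bplug q \o bplug q'.
Proof.
have [L [R qLR]] := context_ex q; have [L' [R' qLR']] := context_ex q'.
have [|q'' h] := @context_of (L ++ L') (R' ++ R).
  rewrite -catA (catA L'); have /balanced_string[w ->] := context_balanced qLR'.
  by apply/balanced_insert; [apply: string_balanced | apply: context_balanced qLR].
by exists q'' => v; apply: bword_inj; rewrite h /= qLR qLR' -!catA.
Qed.

Lemma context_id : exists q, bplug q =1 id.
Proof.
have [|q h] := @context_of [::] [::]; first by [].
by exists q => v; apply: bword_inj; rewrite h cats0.
Qed.

Lemma context_bracket : exists q, bplug q =1 @bracket Z.
Proof.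
have [|q h] := @context_of [:: inr true] [:: inr false]; first by [].
by exists q => v; apply: bword_inj; rewrite h -[RHS]/(string [:: Br v]) string_br.
Qed.

Lemma context_mul u w : exists q, forall v, bplug q v = mmul (mmul u v) w.
Proof.
have [|q h] := @context_of (string u) (string w).
  by rewrite -string_cat; apply: string_balanced.
by exists q => v; apply: bword_inj; rewrite h !string_mul catA.
Qed.

End Contexts.

(** * Linear extensions of maps between monomials *)

Section Lift.
Variable k : fieldType.
Implicit Types K L : choiceType.

HB.instance Definition _ K L (f : K -> L) := GRing.isZmodMorphism.Build
  {malg k[K]} {malg k[L]} (malg_lift f) (malg_lift_zmod_morphism f).

Lemma malg_liftU K L (f : K -> L) (c : k) m :
  malg_lift f << c *g m >> = << c *g f m >>.
Proof.
by rewrite (malg_liftEw _ msuppU_le) big_seq_fset1 mcoeffUU.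
Qed.

Lemma scale_monomial K (c a : k) (m : K) : c *: << a *g m >> = << c * a *g m >>.
Proof. by apply/malgP => n; rewrite mcoeffZ !mcoeffU mulrnAr. Qed.

Lemma malg_lift_scalable K L (f : K -> L) : scalable (malg_lift (k := k) f).
Proof.
move=> c g; rewrite (@malg_liftEw _ _ _ _ _ (msupp g)); last exact: msuppZ_le.
rewrite [malg_lift f g]/malg_lift scaler_sumr; apply: eq_bigr => m _.
by rewrite scale_monomial mcoeffZ.
Qed.

HB.instance Definition _ K L (f : K -> L) := GRing.isScalable.Build k
  {malg k[K]} {malg k[L]} *:%R (malg_lift f) (@malg_lift_scalable K L f).

Lemma malg_lift_subZ K L (h : K -> L) a b (f g : {malg k[K]}) :
  malg_lift h (a *: f - b *: g) = a *: malg_lift h f - b *: malg_lift h g.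
Proof. by rewrite raddfB /= !malg_lift_scalable. Qed.

Lemma malg_lift_comp K L (K' : choiceType) (f : L -> K') (g : K -> L) (p : {malg k[K]}) :
  malg_lift f (malg_lift g p) = malg_lift (f \o g) p.
Proof.
rewrite [malg_lift g p]/malg_lift raddf_sum; apply: eq_bigr => m _.
by rewrite /= malg_liftU.
Qed.

Lemma eq_malg_lift K L (f g : K -> L) : f =1 g -> malg_lift (k := k) f =1 malg_lift g.
Proof. by move=> fg p; apply: eq_bigr => m _; rewrite fg. Qed.

Lemma malg_lift_id K (p : {malg k[K]}) : malg_lift id p = p.
Proof. by rewrite [RHS]monalgE. Qed.

Lemma mcoeff_lift K L (f : K -> L) (p : {malg k[K]}) m :
  injective f -> (malg_lift f p)@_(f m) = p@_m.
Proof.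
move=> fI; rewrite /malg_lift raddf_sum /= [p in RHS]monalgE raddf_sum /=.
by apply: eq_bigr => n _; rewrite !mcoeffU (inj_eq fI).
Qed.

Lemma msupp_lift K L (f : K -> L) (p : {malg k[K]}) n :
  n \in msupp (malg_lift f p) -> exists2 m, m \in msupp p & n = f m.
Proof.
move=> nf; apply: contrapT => no; move: nf; apply/negP; rewrite -mcoeff_eq0.
apply/eqP; rewrite /malg_lift raddf_sum /= big_seq big1 // => m mp.
by rewrite mcoeffU; case: eqP => // fm; case: no; exists m.
Qed.


Lemma mulr_monomialZ (K : monomType) c u (f : {malg k[K]}) :
  f * << c *g u >> = c *: malg_lift (fun m => mmul m u) f.
Proof.
rewrite malgM_def fgmulgU scaler_sumr; apply: eq_bigr => m _.
by rewrite scale_monomial mulrC.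
Qed.

Lemma mull_monomialZ (K : monomType) c u (f : {malg k[K]}) :
  << c *g u >> * f = c *: malg_lift (fun m => mmul u m) f.
Proof.
rewrite malgM_def fgmulUg scaler_sumr; apply: eq_bigr => m _.
by rewrite scale_monomial.
Qed.

Lemma mulr_monomial (K : monomType) (f : {malg k[K]}) u :
  f * << u >> = malg_lift (fun m => mmul m u) f.
Proof. by rewrite mulr_monomialZ scale1r. Qed.

Lemma mull_monomial (K : monomType) (f : {malg k[K]}) u :
  << u >> * f = malg_lift (fun m => mmul u m) f.
Proof. by rewrite mull_monomialZ scale1r. Qed.

End Lift.

(** * The diamond lemma *)

(** The rewriting step of [combination_top]: [x] and [y] have the coefficients
    [a] and [b] at the leading word, and the multiple of [x] is traded for one of
    [y]. *)
Lemma exchange_top (k : fieldType) (V : lmodType k) (c a b d : k) (x y g : V) :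
  a != 0 -> c *: x + g - ((c * a + d) / b) *: y =
    (c * a) *: (a^-1 *: x - b^-1 *: y) + (g - (d / b) *: y).
Proof.
move=> a0; rewrite scalerBr !scalerA mulfK // mulrDl scalerDl opprD.
exact: addrACA.
Qed.

Section Diamond.
Variables (k : fieldType) (L : choiceType).
Local Notation M := {fmonom L}.
Variables (C : Type) (plug : C -> M -> M) (le : rel M).
Hypothesis le_order : monomial_order plug le.
Local Notation lt u v := (le u v && (u != v)).
Local Notation lead := (lead le).
Implicit Types (f g s : {malg k[M]}) (S : set {malg k[M]}) (u v w : M) (q : C).
Implicit Types (P : M -> Prop).

Let le_wo : well_order le. Proof. by case: le_order. Qed.

Lemma mle_total : total le.
Proof.
have H : {in predT &, total le}.
  by apply: wo_chainW => A _; apply: le_wo.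
by move=> x y; apply: H.
Qed.

Lemma mle_refl : reflexive le.
Proof. by move=> x; have := mle_total x x; rewrite orbb. Qed.

Lemma mle_anti : antisymmetric le.
Proof.
have H : {in predT &, antisymmetric le}.
  by apply: wo_chain_antisymmetric => A _; apply: le_wo.
by move=> x y; apply: H.
Qed.

Lemma mle_trans : transitive le.
Proof.
move=> y x z xy yz.
have [|m [[]]] := le_wo (A := mem [:: x; y; z]); first by exists x; apply: mem_head.
rewrite !inE => /or3P[] /eqP-> lbm _.
- by apply: lbm; rewrite !inE eqxx !orbT.
- have yx : le y x by apply: lbm; rewrite !inE eqxx.
  by rewrite (@mle_anti x y) ?xy.
- have zy : le z y by apply: lbm; rewrite !inE eqxx !orbT.
  by rewrite (@mle_anti z y) ?zy.
Qed.

Lemma mlt_ind (P : M -> Prop) :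
  (forall w, (forall v, lt v w -> P v) -> P w) -> forall w, P w.
Proof.
move=> IH w; apply: contrapT => nPw.
have [|m [[/asboolP nPm lbm] _]] := le_wo (A := [pred v | `[< ~ P v >]]).
  by exists w; apply/asboolP.
apply: nPm; apply: IH => v /andP[vm vNm]; apply: contrapT => nPv.
have mv : le m v by apply: lbm; apply/asboolP.
by move: vNm; rewrite (@mle_anti v m) ?vm ?mv ?eqxx.
Qed.

Lemma mle_lt_trans u v w : le u v -> lt v w -> lt u w.
Proof.
move=> uv /andP[vw vNw]; rewrite (mle_trans uv vw) /=; apply: contraNN vNw.
by move=> /eqP uw; rewrite (@mle_anti v w) // vw -uw.
Qed.

Lemma mlt_le_trans u v w : lt u v -> le v w -> lt u w.
Proof.
move=> /andP[uv uNv] vw; rewrite (mle_trans uv vw) /=; apply: contraNN uNv.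
by move=> /eqP uw; rewrite (@mle_anti u v) // uv uw.
Qed.

Lemma mltNge u v : lt u v = ~~ le v u.
Proof.
have [vu|vNu] /= := boolP (le v u).
  by apply/negP => /mlt_le_trans/(_ vu); rewrite eqxx andbF.
have uv : le u v by have := mle_total u v; rewrite (negPf vNu) orbF.
by rewrite uv /=; apply: contraNneq vNu => ->; apply: mle_refl.
Qed.

Lemma plug_lt q u v : lt u v -> lt (plug q u) (plug q v).
Proof. by case: le_order => _; apply. Qed.

Lemma plug_le q u v : le u v -> le (plug q u) (plug q v).
Proof.
move=> uv; have [->|uNv] := eqVneq u v; first exact: mle_refl.
by have /andP[] : lt (plug q u) (plug q v) by apply: plug_lt; rewrite uv.
Qed.

Lemma plug_inj q : injective (plug q).
Proof.
move=> u v quv; apply/eqP; apply: contraT => uNv.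
have [uv|vu] := orP (mle_total u v).
  by have := @plug_lt q u v; rewrite uv uNv quv eqxx andbF => /(_ isT).
by have := @plug_lt q v u; rewrite vu eq_sym uNv quv eqxx andbF => /(_ isT).
Qed.

Lemma lead_supp f : f != 0 -> lead f \in msupp f.
Proof.
rewrite /Defs.lead => f0; case E : (msupp f : seq M) => [|m r].
  by move: f0; rewrite [f]monalgE E big_nil eqxx.
suff : foldr (fun u v => if le u v then v else u) m r \in m :: r by rewrite -E.
elim: r {E} => [|n r IHr] /=; first exact: mem_head.
case: ifP => _; last by rewrite !inE eqxx orbT.
by move: IHr; rewrite !inE => /orP[->|->]; rewrite ?orbT.
Qed.

Lemma lead_ge f m : m \in msupp f -> le m (lead f).
Proof.
rewrite /Defs.lead -[m \in _]/(m \in (msupp f : seq M)).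
case: (msupp f : seq M) => [//|n r].
elim: r m => [|p r IHr] m /=; first by rewrite inE => /eqP->; apply: mle_refl.
case: ifP => pr; rewrite !inE => /or3P[mn|/eqP mp|mr].
- by apply: IHr; rewrite inE mn.
- by rewrite mp.
- by apply: IHr; rewrite inE mr orbT.
- have := mle_total p (foldr (fun u v => if le u v then v else u) n r).
  by rewrite pr /=; apply: mle_trans; apply: IHr; rewrite inE mn.
- by rewrite mp; apply: mle_refl.
- have := mle_total p (foldr (fun u v => if le u v then v else u) n r).
  by rewrite pr /=; apply: mle_trans; apply: IHr; rewrite inE mr orbT.
Qed.

Lemma lead_eq f m :
  m \in msupp f -> (forall n, n \in msupp f -> le n m) -> lead f = m.
Proof.
move=> mf fm; apply: mle_anti; rewrite lead_ge // fm //; apply: lead_supp.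
by apply: contraTneq mf => ->; rewrite msupp0.
Qed.

Lemma msupp_plug q s m : m \in msupp (malg_lift (plug q) s) -> le m (plug q (lead s)).
Proof. by move=> /msupp_lift[n ns ->]; apply/plug_le/lead_ge. Qed.

Lemma mcoeff_plug q s : (malg_lift (plug q) s)@_(plug q (lead s)) = s@_(lead s).
Proof. exact/mcoeff_lift/plug_inj. Qed.

Lemma lcoef_neq0 s : s != 0 -> s@_(lead s) != 0.
Proof. by move=> s0; rewrite mcoeff_neq0; apply: lead_supp. Qed.

(** The sums of [trivial_mod], for an arbitrary condition [P] on the leading words
    [q|_s]. As an inductive predicate, they are added and mapped by induction. *)
Inductive combination S P : {malg k[M]} -> Prop :=
| Comb0 : combination S P 0
| CombS c q s g : S s -> P (plug q (lead s)) -> combination S P g ->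
    combination S P (c *: malg_lift (plug q) s + g).

Lemma combinationS S S' P P' f : (S `<=` S') -> (forall v, P v -> P' v) ->
  combination S P f -> combination S' P' f.
Proof.
move=> SS PP; elim=> [|c q s g Ss Ps _ IH]; first exact: Comb0.
by apply: CombS => //; [apply: SS | apply: PP].
Qed.

Lemma combinationD S P f g :
  combination S P f -> combination S P g -> combination S P (f + g).
Proof.
move=> fS gS; elim: fS => [|c q s h Ss Ps _ IH]; first by rewrite add0r.
by rewrite -addrA; apply: CombS.
Qed.

Lemma combinationZ S P c f : combination S P f -> combination S P (c *: f).
Proof.
elim=> [|a q s h Ss Ps _ IH]; first by rewrite scaler0; apply: Comb0.
by rewrite scalerDr scalerA; apply: CombS.
Qed.

Lemma combinationB S P f g :
  combination S P f -> combination S P g -> combination S P (f - g).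
Proof. by move=> fS gS; apply: combinationD; rewrite // -scaleN1r; apply: combinationZ. Qed.

Lemma combination_sum S P (I : eqType) (r : seq I) (F : I -> {malg k[M]}) :
  (forall i, i \in r -> combination S P (F i)) -> combination S P (\sum_(i <- r) F i).
Proof.
move=> FS; rewrite big_seq; elim/big_ind: _ => //; first exact: Comb0.
by move=> f g; apply: combinationD.
Qed.

Lemma combination1 S P q s :
  S s -> P (plug q (lead s)) -> combination S P (malg_lift (plug q) s).
Proof.
by move=> Ss Ps; rewrite -[malg_lift _ _]scale1r -[_ *: _]addr0; apply/CombS/Comb0.
Qed.

Lemma combination_supp S P f m :
  combination S P f -> m \in msupp f -> exists2 v, P v & le m v.
Proof.
move=> fS; elim: fS m => [|c q s g Ss Ps _ IH] m; first by rewrite msupp0.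
move=> /(fsubsetP (msuppD_le _ _)); rewrite in_fsetU => /orP[/(fsubsetP (msuppZ_le _ _))|/IH//].
by move=> /msupp_plug; exists (plug q (lead s)).
Qed.

Lemma combination_plug S P P' q f :
  (forall q', exists q'', plug q'' =1 plug q \o plug q') ->
  (forall v, P v -> P' (plug q v)) ->
  combination S P f -> combination S P' (malg_lift (plug q) f).
Proof.
move=> comp PP; elim=> [|c q' s g Ss Ps _ IH]; first by rewrite raddf0; apply: Comb0.
rewrite raddfD /= malg_lift_scalable malg_lift_comp; have [q'' qE] := comp q'.
by rewrite -(eq_malg_lift qE); apply: CombS => //; rewrite qE; apply: PP.
Qed.

Lemma trivial_modP S w f :
  trivial_mod plug le S w f -> combination S (fun v => lt v w) f.
Proof.
case=> n [c [q [s [Ss ->]]]]; apply: combination_sum => i _.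
by case: (Ss i) => Si lti; apply/combinationZ/combination1.
Qed.

(** The form in which Groebner-Shirshov bases are used: all the ways in which two
    leading words occur in a word [w] are treated alike, whether they intersect,
    are nested or are disjoint. *)
Definition confluent S : Prop := forall q s q' s',
  S s -> S s' -> s != 0 -> s' != 0 -> plug q (lead s) = plug q' (lead s') ->
  combination S (fun v => lt v (plug q (lead s)))
    ((s@_(lead s))^-1 *: malg_lift (plug q) s
     - (s'@_(lead s'))^-1 *: malg_lift (plug q') s').

Lemma combination_le S P f : combination S P f ->
  f = 0 \/ exists2 w, P w & combination S (fun v => le v w) f.
Proof.
elim=> [|c q s g Ss Ps _ [->|[w Pw gS]]]; first by left.
  rewrite addr0; right; exists (plug q (lead s)) => //.
  by apply/combinationZ/combination1 => //; apply: mle_refl.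
right; have [le_w|w_le] := orP (mle_total (plug q (lead s)) w).
  by exists w => //; apply: CombS.
exists (plug q (lead s)) => //; apply: CombS => //; first exact: mle_refl.
by apply: combinationS gS => // v vw; apply: mle_trans w_le.
Qed.

(** The top terms of a combination share their leading word [w], so that confluence
    collects them into one term, whose coefficient is the coefficient of [w]. *)
Lemma combination_top S w f : confluent S ->
  combination S (fun v => le v w) f -> combination S (fun v => lt v w) f \/
  exists q s, [/\ S s, s != 0, plug q (lead s) = w &
    combination S (fun v => lt v w)
      (f - (f@_w / s@_(lead s)) *: malg_lift (plug q) s)].
Proof.
move=> confS; elim=> [|c q s g Ss le_w _ IH]; first by left; apply: Comb0.
have lt_w0 h : combination S (fun v => lt v w) h -> h@_w = 0.
  move=> hS; apply: mcoeff_outdom; apply/negP => /(combination_supp hS)[v vw].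
  by rewrite -[le _ _]negbK -mltNge vw.
have [->|s0] := eqVneq s 0; first by rewrite raddf0 scaler0 add0r.
have [qw|qNw] := eqVneq (plug q (lead s)) w; last first.
  have c_lt : combination S (fun v => lt v w) (c *: malg_lift (plug q) s).
    by apply/combinationZ/combination1 => //; rewrite le_w.
  case: IH => [gS|[q' [s' [Ss' s0' qw' gS']]]]; [left|right].
    exact: combinationD c_lt gS.
  exists q', s'; split; [exact: Ss' | exact: s0' | exact: qw' | ].
  by rewrite mcoeffD (lt_w0 _ c_lt) add0r -addrA; apply: combinationD.
right; case: IH => [gS|[q' [s' [Ss' s0' qw' gS']]]].
  exists q, s; split; [exact: Ss | exact: s0 | exact: qw | ].
  rewrite mcoeffD mcoeffZ (lt_w0 _ gS) -[X in _ * _@_X]qw mcoeff_plug.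
  by rewrite addr0 mulfK ?lcoef_neq0 // addrC addKr.
exists q', s'; split; [exact: Ss' | exact: s0' | exact: qw' | ].
have Xw : (malg_lift (plug q) s)@_w = s@_(lead s) by rewrite -qw mcoeff_plug.
rewrite mcoeffD mcoeffZ Xw (exchange_top _ _ _ _ _ _ (lcoef_neq0 s0)).
apply: combinationD gS'; apply: combinationZ.
have := confS _ _ _ _ Ss Ss' s0 s0' (etrans qw (esym qw')).
by rewrite qw.
Qed.

(** If the bound [w] of a combination is not a monomial of [f], the top terms cancel
    by [combination_top] and the bound decreases; the order is well founded. *)
Lemma diamond S P f : confluent S -> combination S P f -> f != 0 ->
  combination S (fun v => le v (lead f)) f /\
  exists q s, [/\ S s, s != 0 & lead f = plug q (lead s)].
Proof.
move=> confS /combination_le[->|[w _]]; first by rewrite eqxx.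
elim/mlt_ind: w f => w IH f fS f0.
have small : combination S (fun v => lt v w) f ->
    combination S (fun v => le v (lead f)) f /\
    exists q s, [/\ S s, s != 0 & lead f = plug q (lead s)].
  by move=> /combination_le[fE|[v vw fv]]; [rewrite fE eqxx in f0 | apply: IH fv f0].
case: (combination_top confS fS) => // -[q [s [Ss s0 qw fS']]].
have [fw|fw] := eqVneq f@_w 0; first by apply: small; rewrite fw mul0r scale0r subr0 in fS'.
suff -> : lead f = w by split=> //; exists q, s.
apply: lead_eq; first by rewrite -mcoeff_neq0.
by move=> m /(combination_supp fS)[v vw mv]; apply: mle_trans vw.
Qed.

End Diamond.

(** * Compositions resolve all critical pairs *)

Lemma cat_le (T : Type) (A B C D : seq T) : A ++ B = C ++ D -> (size A <= size C)%N ->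
  exists2 E, C = A ++ E & B = E ++ D.
Proof.
elim: A C => [|x A IHA] C /=; first by move=> -> _; exists C.
by case: C => // y C [-> /IHA H /H[E -> ->]]; exists E.
Qed.

(** Two disjoint occurrences can be replaced in either order. *)
Lemma exchange_lift (k : fieldType) (K : choiceType) (c1 c2 : K -> K -> K)
    (f g : {malg k[K]}) : (forall u v, c1 v u = c2 u v) ->
  \sum_(v <- msupp g) g@_v *: malg_lift (c1 v) f =
  \sum_(u <- msupp f) f@_u *: malg_lift (c2 u) g.
Proof.
move=> c12.
transitivity (\sum_(v <- msupp g) \sum_(u <- msupp f) << g@_v * f@_u *g c1 v u >>).
  apply: eq_bigr => v _; rewrite scaler_sumr; apply: eq_bigr => u _.
  exact: scale_monomial.
rewrite exchange_big; apply: eq_bigr => u _ /=; rewrite scaler_sumr.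
by apply: eq_bigr => v _; rewrite c12 mulrC scale_monomial.
Qed.

Lemma exchange_sub (V : zmodType) (a b c d : V) : a + b = c + d -> a - c = d - b.
Proof. by move=> ab; apply/eqP; rewrite subr_eq addrAC eq_sym subr_eq ab addrC. Qed.

Section Confluence.
Variables (k : fieldType) (Z : choiceType) (le : rel {bword Z}).
Hypothesis le_order : monomial_order (@bplug Z) le.
Local Notation lt u v := (le u v && (u != v)).
Local Notation lead := (lead le).
Local Notation monicize := (monicize le).
Implicit Types (f g s : {malg k[{bword Z}]}) (S : set {malg k[{bword Z}]}).
Implicit Types (u v w : {bword Z}) (q : starword Z).

Lemma lead_monicize s : s != 0 -> lead (monicize s) = lead s.
Proof.
by move=> s0; rewrite /Defs.lead msuppZ invr_eq0 (negPf (lcoef_neq0 le s0)).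
Qed.

Lemma lcoef_monicize s : s != 0 -> (monicize s)@_(lead s) = 1.
Proof. by move=> s0; rewrite mcoeffZ mulVf // lcoef_neq0. Qed.

Lemma combinationZ1 S (P : {bword Z} -> Prop) c q s : S s -> P (bplug q (lead s)) ->
  combination (@bplug Z) le S P (malg_lift (bplug q) (c *: s)).
Proof. by move=> Ss Ps; rewrite malg_lift_scalable; apply/combinationZ/combination1. Qed.

Lemma lt_supp s v : v \in msupp s -> v != lead s -> lt v (lead s).
Proof. by move=> vs ->; rewrite (lead_ge le_order). Qed.


Lemma balanced_middle (A B C : seq (Z + bool)) v :
  B = string v -> balanced (A ++ B ++ C) -> balanced (A ++ C).
Proof. by move=> ->; move=> /balanced_insert; apply; apply: string_balanced. Qed.

(** [c1 v] and [c2 u] are obtained from a word with two holes by filling the second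
    and the first one. *)
Lemma context_two_holes L M R : balanced (L ++ M ++ R) ->
  exists c1 c2 : {bword Z} -> starword Z,
    (forall v, context (c1 v) L (M ++ string v ++ R)) /\
    (forall u, context (c2 u) (L ++ string u ++ M) R).
Proof.
move=> bal.
have H1 v : exists q, context q L (M ++ string v ++ R).
  apply: context_of; rewrite catA; apply/balanced_insert; first exact: string_balanced.
  by rewrite -catA.
have H2 u : exists q, context q (L ++ string u ++ M) R.
  by apply: context_of; rewrite -!catA; apply/balanced_insert; first exact: string_balanced.
by have [c1 h1] := choice H1; have [c2 h2] := choice H2; exists c1, c2.
Qed.

Local Notation resolved S q s q' s' :=
  (combination (@bplug Z) le S (fun v => lt v (bplug q (lead s)))
    (malg_lift (bplug q) (monicize s) - malg_lift (bplug q') (monicize s'))).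

(** In the double sum over the monomials of both elements, all the terms except
    those of the two leading words are below their common leading word. *)
Lemma disjoint_resolved S q s q' s' L M R : S s -> S s' -> s != 0 -> s' != 0 ->
  context q L (M ++ string (lead s') ++ R) ->
  context q' (L ++ string (lead s) ++ M) R -> resolved S q s q' s'.
Proof.
move=> Ss Ss' s0 s0' qc qc'.
have [|c1 [c2 [h1 h2]]] := @context_two_holes L M R.
  move/context_balanced: qc; rewrite catA => /balanced_middle.
  by rewrite -catA; apply.
have c12 u v : bplug (c1 v) u = bplug (c2 u) v.
  by apply: bword_inj; rewrite h1 h2 !catA.
have qE : bplug q =1 bplug (c1 (lead s')).
  by move=> u; apply: bword_inj; rewrite qc h1.
have qE' : bplug q' =1 bplug (c2 (lead s)).
  by move=> u; apply: bword_inj; rewrite qc' h2.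
rewrite (eq_malg_lift qE) (eq_malg_lift qE') qE.
move FE : (monicize s) => F; move GE : (monicize s') => G.
have F1 : F@_(lead s) = 1 by rewrite -FE lcoef_monicize.
have G1 : G@_(lead s') = 1 by rewrite -GE lcoef_monicize.
have Fs : lead s \in msupp F by rewrite -mcoeff_neq0 F1 oner_neq0.
have Gs : lead s' \in msupp G by rewrite -mcoeff_neq0 G1 oner_neq0.
have Flt u : u \in msupp F -> u != lead s -> lt u (lead s).
  by rewrite -FE => /(fsubsetP (msuppZ_le _ _)); apply: lt_supp.
have Glt v : v \in msupp G -> v != lead s' -> lt v (lead s').
  by rewrite -GE => /(fsubsetP (msuppZ_le _ _)); apply: lt_supp.
have := exchange_lift F G (c1 := fun v => bplug (c1 v))
  (c2 := fun u => bplug (c2 u)) c12.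
rewrite (big_fsetD1 _ Gs) [RHS](big_fsetD1 _ Fs) /= F1 G1 !scale1r.
move=> /exchange_sub ->.
apply: combinationB; apply: combination_sum => v; rewrite in_fsetD1 => /andP[vN vin];
  apply: combinationZ; rewrite -?FE -?GE; apply: combinationZ1 => //.
  by rewrite -c12; apply: (plug_lt le_order); apply: Flt.
by rewrite !c12; apply: (plug_lt le_order); apply: Glt.
Qed.

Lemma inclusion_resolved S q s q' s' P Q L R : GS_basis (@bplug Z) le S ->
  S s -> S s' -> s != 0 -> s' != 0 -> context q L R ->
  string (lead s) = P ++ string (lead s') ++ Q -> context q' (L ++ P) (Q ++ R) ->
  resolved S q s q' s'.
Proof.
move=> GS Ss Ss' s0 s0' qc sE qc'.
have [|p pc] := @context_of _ P Q.
  have := string_balanced (lead s); rewrite sE => /balanced_insert; apply.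
  exact: string_balanced.
have leadE : lead s = bplug p (lead s') by apply: bword_inj; rewrite pc.
move: (GS s s' Ss s0 Ss' s0') (lead_monicize s0) (lead_monicize s0').
move: (monicize s) (monicize s') => F G [_] + FE GE; rewrite /incl_trivial FE GE.
move=> /(_ p leadE) /trivial_modP /(combination_plug (@context_comp Z q)).
move=> /(_ (fun v => lt v (bplug q (lead s))) (fun v => @plug_lt _ _ _ _ le_order q v _)).
rewrite raddfB /= malg_lift_comp.
rewrite (@eq_malg_lift _ _ _ (bplug q \o bplug p) (bplug q')) // => v.
by apply: bword_inj; rewrite /= qc pc qc' -!catA.
Qed.

Lemma intersection_resolved S q s q' s' P T Q L R : GS_basis (@bplug Z) le S ->
  S s -> S s' -> s != 0 -> s' != 0 ->
  string (lead s) = P ++ T -> string (lead s') = T ++ Q ->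
  (0 < size P)%N -> (0 < size T)%N -> (0 < size Q)%N ->
  context q L (Q ++ R) -> context q' (L ++ P) R -> resolved S q s q' s'.
Proof.
move=> GS Ss Ss' s0 s0' sE sE' P0 T0 Q0 qc qc'.
have [] := @balanced_overlap _ P T Q.
- by rewrite -sE; apply: string_balanced.
- by rewrite -sE'; apply: string_balanced.
move=> /balanced_string[v vE] /balanced_string[t tE] /balanced_string[u uE].
have fE : lead s = v ++ t :> seq _ by apply: string_inj; rewrite sE vE tE string_cat.
have gE : lead s' = t ++ u :> seq _ by apply: string_inj; rewrite sE' uE tE string_cat.
have pos (x : seq (letter Z)) A : A = string x -> (0 < size A)%N -> (0 < size x)%N.
  by move=> ->; case: x.
have [v0 t0 u0] := And3 (pos _ _ vE P0) (pos _ _ tE T0) (pos _ _ uE Q0).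
move: (GS s s' Ss s0 Ss' s0') (lead_monicize s0) (lead_monicize s0').
move: (monicize s) (monicize s') => F G [+ _] FE GE; rewrite /inter_trivial FE GE.
move=> /(_ (FMonom u) (FMonom v) (mmul (lead s) (FMonom u)) erefl).
case.
- by apply: bword_inj; rewrite !string_mul sE sE' /= -vE -uE catA.
- by rewrite /fdeg /mmul /= fmmulE /= fE gE !size_cat; lia.
move=> n [c [x [y [xy E]]]].
have := trivial_modP (ex_intro _ n (ex_intro _ c (ex_intro _ x (ex_intro _ y (conj xy E))))).
have [|p pc] := @context_of _ L R.
  by move: (context_balanced qc); rewrite uE => /balanced_insert; apply; apply: string_balanced.
move=> /(combination_plug (@context_comp Z p)).
move=> /(_ (fun v => lt v (bplug q (lead s)))).
have pE w : bplug p (mmul w (FMonom u)) = bplug q w.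
  by apply: bword_inj; rewrite pc qc string_mul /= uE -!catA.
have pE' w : bplug p (mmul (FMonom v) w) = bplug q' w.
  by apply: bword_inj; rewrite pc qc' string_mul /= vE -!catA.
rewrite -pE => /(_ (fun v => @plug_lt _ _ _ _ le_order p v _)).
rewrite raddfB /= mulr_monomial mull_monomial !malg_lift_comp.
by rewrite (eq_malg_lift pE) (eq_malg_lift pE').
Qed.

(** The positions of the two leading words in the string of their common word are
    disjoint, nested or overlapping. In the last case [balanced_overlap] shows
    that both words sit at the same level, as an intersection composition
    requires. *)
Lemma GS_confluent S : GS_basis (@bplug Z) le S -> confluent (@bplug Z) le S.
Proof.
move=> GS.
suff H q s q' s' L R L' R' : S s -> S s' -> s != 0 -> s' != 0 ->
    bplug q (lead s) = bplug q' (lead s') -> context q L R -> context q' L' R' ->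
    (size L <= size L')%N -> resolved S q s q' s'.
  move=> q s q' s' Ss Ss' s0 s0' qq'.
  have [L [R qc]] := context_ex q; have [L' [R' qc']] := context_ex q'.
  have [LL'|L'L] := orP (leq_total (size L) (size L')).
    by have := H _ _ _ _ _ _ _ _ Ss Ss' s0 s0' qq' qc qc' LL'; rewrite !malg_lift_scalable.
  have := H _ _ _ _ _ _ _ _ Ss' Ss s0' s0 (esym qq') qc' qc L'L.
  rewrite !malg_lift_scalable => /(combinationZ (-1)).
  by rewrite scaleN1r opprB qq'.
move=> Ss Ss' s0 s0' qq' qc qc' LL'.
have := congr1 (fun w : {bword Z} => string w) qq'; rewrite qc qc' => E.
have [A LA EA] := cat_le E LL'; rewrite LA in E LL' qc'.
have [fA|Af] := leqP (size (string (lead s))) (size A).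
  have [M AM RE] := cat_le EA fA.
  by apply: (@disjoint_resolved S q s q' s' L M R'); rewrite // -?RE -?AM.
have [T fE TE] := cat_le (esym EA) (ltnW Af).
have [gT|Tg] := leqP (size (string (lead s'))) (size T).
  have [Q TQ R'E] := cat_le TE gT.
  apply: (@inclusion_resolved S q s q' s' A Q L R); rewrite -?TQ -?fE //.
  by rewrite -R'E.
have [Q gE RE] := cat_le (esym TE) (ltnW Tg).
have Q0 : (0 < size Q)%N by move: Tg; rewrite gE size_cat; lia.
have T0 : (0 < size T)%N by move: Af; rewrite fE size_cat; lia.
case: (posnP (size A)) => [A0|A0]; last first.
  by apply: (@intersection_resolved S q s q' s' A T Q L R'); rewrite -?RE.
(* Both words start at the same place, and the second one is the longer. *)
have := @inclusion_resolved S q' s' q s [::] Q (L ++ A) R' GS Ss' Ss s0' s0 qc'.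
rewrite /= fE gE (size0nil A0) /= !cats0 -RE => /(_ erefl qc).
move=> /(combinationZ (-1)); rewrite scaleN1r opprB qq'; exact.
Qed.

End Confluence.

(** * Groebner-Shirshov bases of the free associative algebra *)

Section Restriction.
Variables (k : fieldType) (Z : choiceType) (le : rel {bword Z}).
Hypothesis le_order : monomial_order (@bplug Z) le.
Local Notation leW := (relpre (@word_bword Z) le).
Local Notation incl := (malg_lift (@word_bword Z)).
Implicit Types (f g s : {malg k[{fmonom Z}]}) (G : set {malg k[{fmonom Z}]}).

Lemma string_word (v : {fmonom Z}) : string (word_bword v) = map inl v.
Proof. exact: string_var. Qed.

Lemma word_bwordE (u : {bword Z}) (s : seq Z) :
  u = map (@Var Z) s :> seq _ -> u = word_bword (FMonom s).
Proof. by case: u => u /= ->. Qed.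

Lemma word_bword_inj : injective (@word_bword Z).
Proof.
move=> v w /(congr1 (fun w : {bword Z} => string w)); rewrite !string_word.
by move=> /inj_map vw; apply: val_inj; apply: vw => x y [].
Qed.

Lemma word_bword_mul (v w : {fmonom Z}) :
  word_bword (mmul v w) = mmul (word_bword v) (word_bword w).
Proof. by apply: val_inj; rewrite /mmul /= !fmmulE /= map_cat. Qed.

Lemma context_word (q : {fmonom Z} * {fmonom Z}) : exists q' : starword Z,
  forall v, bplug q' v = mmul (mmul (word_bword q.1) v) (word_bword q.2).
Proof. exact: context_mul. Qed.

Lemma restriction_order : monomial_order (@wplug Z) leW.
Proof.
have [wo mono] := le_order; split=> [A [x Ax]|q u v].
  have [|m [[/asboolP[v [Av ->]] lbm] _]] :=
      wo [pred w | `[< exists v, v \in A /\ w = word_bword v >]].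
    by exists (word_bword x); apply/asboolP; exists x.
  have lbv : minimum_of leW A v.
    by split=> // y Ay; apply: lbm; apply/asboolP; exists y.
  exists v; split=> // y [Ay lby]; apply: word_bword_inj.
  by apply: (mle_anti le_order); apply/andP; split; [case: lbv => _; apply | apply: lby].
have [q' qE] := context_word q.
have H w : word_bword (wplug q w) = bplug q' (word_bword w).
  by rewrite qE !word_bword_mul.
move=> /andP[uv uNv]; have := mono q' (word_bword u) (word_bword v).
rewrite (inj_eq word_bword_inj) [le _ _]uv uNv => /(_ isT).
by rewrite -!H (inj_eq word_bword_inj).
Qed.

Lemma mcoeff_incl f v : (incl f)@_(word_bword v) = f@_v.
Proof. exact/mcoeff_lift/word_bword_inj. Qed.

Lemma incl_eq0 f : (incl f == 0) = (f == 0).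
Proof.
apply/eqP/eqP => [f0|->]; last by rewrite raddf0.
by apply/malgP => v; rewrite -mcoeff_incl f0 !mcoeff0.
Qed.

Lemma lead_incl f : lead le (incl f) = word_bword (lead leW f).
Proof.
have [->|f0] := eqVneq f 0.
  by rewrite raddf0 /lead !msupp0 /=; apply: val_inj; rewrite /= !fm1.
apply: (lead_eq le_order).
  by rewrite -mcoeff_neq0 mcoeff_incl lcoef_neq0.
by move=> m /msupp_lift[v vf ->]; apply: (lead_ge restriction_order vf).
Qed.

Lemma monicize_incl f : monicize le (incl f) = incl (monicize leW f).
Proof. by rewrite /monicize lead_incl mcoeff_incl malg_lift_scalable. Qed.

Lemma trivial_mod_incl G w f : trivial_mod (@wplug Z) leW G w f ->
  trivial_mod (@bplug Z) le (incl @` G) (word_bword w) (incl f).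
Proof.
case=> n [c [q [s [Gs ->]]]].
have /choice[q' qE] : forall i, exists q' : starword Z,
    forall v, bplug q' v = mmul (mmul (word_bword (q i).1) v) (word_bword (q i).2).
  by move=> i; apply: context_word.
have qE' i v : word_bword (wplug (q i) v) = bplug (q' i) (word_bword v).
  by rewrite qE !word_bword_mul.
exists n, c, q', (fun i => incl (s i)); split=> [i|].
  have [Gi /andP[lei Ni]] := Gs i; split; first by exists (s i).
  by rewrite lead_incl -qE' (inj_eq word_bword_inj) [le _ _]lei.
rewrite raddf_sum; apply: eq_bigr => i _ /=.
rewrite malg_lift_scalable !malg_lift_comp; congr (_ *: _).
exact/eq_malg_lift/qE'.
Qed.

Lemma map_eq_cat (T U : Type) (h : T -> U) (c : seq T) (A B : seq U) :
  map h c = A ++ B -> exists a b, [/\ c = a ++ b, A = map h a & B = map h b].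
Proof.
move=> E; exists (take (size A) c), (drop (size A) c); split.
- by rewrite cat_take_drop.
- by rewrite map_take E take_size_cat.
- by rewrite map_drop E drop_size_cat.
Qed.

(** In an intersection composition of bracket-free words, both cofactors are factors
    of these words, hence bracket-free. *)
Lemma inter_trivial_incl G f g F H : F = incl f -> H = incl g ->
  lead le F = word_bword (lead leW f) -> lead le H = word_bword (lead leW g) ->
  inter_trivial (@wplug Z) leW G f g ->
  inter_trivial (@bplug Z) le (incl @` G) F H.
Proof.
move=> Ff Hg Flead Hlead; rewrite /inter_trivial /fdeg Flead Hlead.
move: (lead leW f) (lead leW g) => a b inter u v w; rewrite /= !size_map.
move=> wu wv /andP[]; rewrite gtn_max => /andP[aw bw] wab.
have := congr1 val (etrans (esym wu) wv); rewrite /mmul /= !fmmulE /= => E.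
have wvE : size w = (size v + size b)%N.
  by rewrite wv /mmul /= fmmulE /= size_cat size_map.
have [|t aE bE] := cat_le (esym E).
  by rewrite size_map -(leq_add2r (size b)) -wvE ltnW.
have [v0 [t0 [a0 v0E t0E]]] := map_eq_cat aE.
have [t1 [u0 [b0 t1E u0E]]] := map_eq_cat bE.
have uE := word_bwordE u0E.
have vE := word_bwordE v0E.
have wE : w = word_bword (mmul a (FMonom u0)) by rewrite word_bword_mul wu uE.
have := inter (FMonom u0) (FMonom v0) (mmul a (FMonom u0)) erefl; case.
- by apply: word_bword_inj; rewrite -wE wv vE word_bword_mul.
- have := congr1 (fun w : {bword Z} => size w) wE; rewrite /fdeg /= size_map => <-.
  by rewrite gtn_max aw bw wab.
move=> n [c [x [y [xy D]]]].
have := trivial_mod_incl (ex_intro _ n (ex_intro _ c (ex_intro _ x (ex_intro _ y (conj xy D))))).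
rewrite -wE raddfB /= (mulr_monomial f) (mull_monomial g) !malg_lift_comp.
rewrite Ff Hg uE vE (mulr_monomial (incl f)) (mull_monomial (incl g)) !malg_lift_comp.
have muE : @word_bword Z \o (fun m => mmul m (FMonom u0)) =1
    (fun m => mmul m (word_bword (FMonom u0))) \o @word_bword Z.
  by move=> m /=; rewrite word_bword_mul.
have mvE : @word_bword Z \o (fun m => mmul (FMonom v0) m) =1
    (fun m => mmul (word_bword (FMonom v0)) m) \o @word_bword Z.
  by move=> m /=; rewrite word_bword_mul.
by rewrite (eq_malg_lift muE) (eq_malg_lift mvE).
Qed.

(** A word with a star is bracket-free as soon as one of its values is. *)
Lemma incl_trivial_incl G f g F H : F = incl f -> H = incl g ->
  lead le F = word_bword (lead leW f) -> lead le H = word_bword (lead leW g) ->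
  incl_trivial (@wplug Z) leW G f g ->
  incl_trivial (@bplug Z) le (incl @` G) F H.
Proof.
move=> Ff Hg Flead Hlead incl_tr q; rewrite Flead Hlead => FE.
have [L [R qc]] := context_ex q.
have := congr1 (fun w : {bword Z} => string w) FE.
rewrite qc !string_word => /map_eq_cat[a [bc [F0 LE]]] /esym/map_eq_cat[b [c [bcE _ RE]]].
have qE v : bplug q (word_bword v) = word_bword (wplug (FMonom a, FMonom c) v).
  by apply: bword_inj; rewrite qc !string_word /wplug /mmul /= !fmmulE /= !map_cat LE RE catA.
have := incl_tr (FMonom a, FMonom c); case.
  by apply: word_bword_inj; rewrite -qE.
move=> n [d [x [y [xy D]]]].
have := trivial_mod_incl (ex_intro _ n (ex_intro _ d (ex_intro _ x (ex_intro _ y (conj xy D))))).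
congr (trivial_mod _ _ _ _ _); rewrite raddfB /= Ff Hg !malg_lift_comp; congr (_ - _).
by apply: eq_malg_lift => v /=; rewrite qE.
Qed.

Lemma GS_basis_incl G :
  GS_basis (@wplug Z) leW G -> GS_basis (@bplug Z) le (incl @` G).
Proof.
move=> GS _ _ [f Gf <-] f0 [g Gg <-] g0; rewrite incl_eq0 in f0; rewrite incl_eq0 in g0.
have [inter incl_tr] := GS f g Gf f0 Gg g0.
have lead_mon (h : {malg k[{fmonom Z}]}) :
    lead le (monicize le (incl h)) = word_bword (lead leW (monicize leW h)).
  by rewrite monicize_incl lead_incl.
split.
  by apply: inter_trivial_incl inter => //; apply: monicize_incl.
by apply: incl_trivial_incl incl_tr => //; apply: monicize_incl.
Qed.

End Restriction.

(** * Generated ideals *)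

Section GeneratedIdeals.

Lemma ideal_gen_min (A : pzRingType) (S : set A) (P : A -> Prop) :
  P 0 -> (forall x y, P x -> P y -> P (x - y)) ->
  (forall a x, P x -> P (a * x)) -> (forall a x, P x -> P (x * a)) ->
  S `<=` P -> forall x, x \in ideal_gen S -> P x.
Proof.
move=> P0 PB PMl PMr SP x /asboolP xS.
pose p : A -> bool := fun x => `[< P x >].
have pz : zmod_closed p.
  by split=> [|y z /asboolP Py /asboolP Pz]; apply/asboolP => //; apply: PB.
have pl a y : y \in p -> a * y \in p by move=> /asboolP Py; apply/asboolP/PMl.
have pr a y : y \in p -> y * a \in p by move=> /asboolP Py; apply/asboolP/PMr.
pose J : idealType A := HB.pack p (GRing.isZmodClosed.Build A p pz)
  (isTwoSidedIdeal.Build A p pl pr).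
by apply/asboolP/(xS J) => s Ss; apply/asboolP/SP.
Qed.

Lemma opIdeal_gen_min (k : fieldType) (A : uOpAlgType k) (S : set A) (P : A -> Prop) :
  P 0 -> (forall x y, P x -> P y -> P (x - y)) ->
  (forall a x, P x -> P (a * x)) -> (forall a x, P x -> P (x * a)) ->
  (forall x, P x -> P (oper x)) ->
  S `<=` P -> forall x, x \in opIdeal_gen S -> P x.
Proof.
move=> P0 PB PMl PMr Po SP x /asboolP xS.
pose p : A -> bool := fun x => `[< P x >].
have pz : zmod_closed p.
  by split=> [|y z /asboolP Py /asboolP Pz]; apply/asboolP => //; apply: PB.
have pl a y : y \in p -> a * y \in p by move=> /asboolP Py; apply/asboolP/PMl.
have pr a y : y \in p -> y * a \in p by move=> /asboolP Py; apply/asboolP/PMr.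
have po y : y \in p -> oper y \in p by move=> /asboolP Py; apply/asboolP/Po.
pose J : opIdealType A := HB.pack p (GRing.isZmodClosed.Build A p pz)
  (isTwoSidedIdeal.Build A p pl pr) (isOperClosed.Build k A p po).
by apply/asboolP/(xS J) => s Ss; apply/asboolP/SP.
Qed.

Lemma mem_ideal_gen (A : pzRingType) (S : set A) s : S s -> s \in ideal_gen S.
Proof. by move=> Ss; apply/asboolP => J; apply. Qed.

Lemma mem_opIdeal_gen (k : fieldType) (A : uOpAlgType k) (S : set A) s :
  S s -> s \in opIdeal_gen S.
Proof. by move=> Ss; apply/asboolP => J; apply. Qed.

End GeneratedIdeals.

(** * Evaluation of bracketed words *)

Section ZmodMorphism.
Variables (U V : zmodType) (h : U -> V).
Hypothesis hB : zmod_morphism h.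

Lemma zmod_morphism0 : h 0 = 0.
Proof. by rewrite -(subrr (0 : U)) hB subrr. Qed.

Lemma zmod_morphismD : {morph h : x y / x + y}.
Proof.
have hN y : h (- y) = - h y by rewrite -[- y]add0r hB zmod_morphism0 sub0r.
by move=> x y; rewrite -[y in LHS]opprK hB hN opprK.
Qed.

Lemma zmod_morphism_sum (I : Type) (t : seq I) (F : I -> U) :
  h (\sum_(i <- t) F i) = \sum_(i <- t) h (F i).
Proof. exact: (big_morph h zmod_morphismD zmod_morphism0). Qed.

End ZmodMorphism.

Lemma count_string_br (X : eqType) (x : X) (v s : seq (letter X)) :
  count_mem (inl x) (string (Br v :: s)) =
  (count_mem (inl x) (string v) + count_mem (inl x) (string s))%N.
Proof. by rewrite string_br /= count_cat. Qed.

Section Evaluation.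
Variables (k : fieldType) (X : choiceType).
Implicit Types (B : uOpAlgType k) (w : {bword X}) (x : X).

(** [word_eval] on lists of letters, on which the recursion runs. *)
Definition letters_eval B (r : X -> B) (s : seq (letter X)) : B :=
  foldr (fun l b => letter_eval r l * b) 1 s.

Lemma word_evalE B (r : X -> B) w : word_eval r w = letters_eval r w.
Proof.
rewrite /word_eval; elim: (w : seq _) => [|l s IHs]; first by rewrite big_nil.
by rewrite big_cons IHs.
Qed.

Lemma letters_eval_var B (r : X -> B) x s :
  letters_eval r (Var x :: s) = r x * letters_eval r s.
Proof. by []. Qed.

Lemma letters_eval_br B (r : X -> B) v s :
  letters_eval r (Br v :: s) = oper (letters_eval r v) * letters_eval r s.
Proof. by []. Qed.

Lemma letters_eval_cat B (r : X -> B) s t :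
  letters_eval r (s ++ t) = letters_eval r s * letters_eval r t.
Proof. by elim: s => [|l s /= ->]; rewrite ?mul1r ?mulrA. Qed.

Lemma eq_in_letters_eval B (r r' : X -> B) (s : seq (letter X)) :
  (forall x, inl x \in string s -> r x = r' x) -> letters_eval r s = letters_eval r' s.
Proof.
elim/letters_ind: s => [//|x s IHs|v s IHv IHs] rr'.
  rewrite !letters_eval_var (rr' x) ?mem_head // IHs // => y ys.
  by apply: rr'; rewrite in_cons ys orbT.
rewrite !letters_eval_br IHv ?IHs // => x xs; apply: rr';
  by rewrite string_br in_cons mem_cat in_cons xs !orbT.
Qed.

Definition update (T : Type) (r : X -> T) x (b : T) : X -> T :=
  fun y => if y == x then b else r y.

Lemma letters_eval_update0 B (r : X -> B) x b s : count_mem (inl x) (string s) = 0%N ->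
  letters_eval (update r x b) s = letters_eval r s.
Proof.
move=> x0; apply: eq_in_letters_eval => y ys; rewrite /update; case: eqP => // yx.
by move: ys; rewrite yx -has_pred1 has_count x0.
Qed.

Lemma letters_eval_linear B (r : X -> B) x c a b s : count_mem (inl x) (string s) = 1%N ->
  letters_eval (update r x (scal c * a + b)) s =
  scal c * letters_eval (update r x a) s + letters_eval (update r x b) s.
Proof.
elim/letters_ind: s => [//|y s IHs|v s IHv IHs].
  rewrite string_var_cons !letters_eval_var [count_mem _ _]/=.
  rewrite -[inl y == inl x]/(y == x) {1 3 5}/update; case: (eqVneq y x) => [_ [s0]|_ s1].
    by rewrite !(letters_eval_update0 _ _ s0) mulrDl mulrA.
  by rewrite IHs // mulrDr !mulrA scal_central.
rewrite count_string_br !letters_eval_br => vs1.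
have [v0|v0] := eqVneq (count_mem (inl x) (string v)) 0%N.
  rewrite v0 in vs1; rewrite !(letters_eval_update0 _ _ v0) IHs //.
  by rewrite mulrDr !mulrA scal_central.
have [v1 s0] : count_mem (inl x) (string v) = 1%N /\ count_mem (inl x) (string s) = 0%N.
  by case: (count_mem (inl x) (string v)) vs1 v0 => [|[|n]] //; rewrite addSn => -[].
rewrite !(letters_eval_update0 _ _ s0) IHv //.
rewrite (zmod_morphismD (@oper_zmod_morphism k B)) oper_scal mulrDl.
by rewrite mulrA.
Qed.


Lemma scal0 B : scal 0 = 0 :> B.
Proof. exact: zmod_morphism0 (@scal_zmod_morphism k B). Qed.

Lemma scal1 B : scal 1 = 1 :> B.
Proof. by have [] := @scal_monoid_morphism k B. Qed.

Lemma scalM B a b : scal (a * b) = scal a * scal b :> B.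
Proof. by have [_ ->] := @scal_monoid_morphism k B. Qed.

Lemma letters_eval_sum B (r : X -> B) x (I : Type) (t : seq I) (c : I -> k) (b : I -> B) s :
  count_mem (inl x) (string s) = 1%N ->
  letters_eval (update r x (\sum_(i <- t) scal (c i) * b i)) s =
  \sum_(i <- t) scal (c i) * letters_eval (update r x (b i)) s.
Proof.
move=> s1; elim: t => [|i t IHt]; last by rewrite !big_cons letters_eval_linear // IHt.
rewrite !big_nil; have := letters_eval_linear r 1 0 0 s1.
rewrite mulr0 addr0 scal1 mul1r => /eqP.
by rewrite -[X in X == _]addr0 (inj_eq (addrI _)) => /eqP <-.
Qed.

Lemma OPI_evalEw B (phi : {malg k[{bword X}]}) (d : {fset {bword X}}) (r : X -> B) :
  (msupp phi `<=` d)%fset -> OPI_eval phi r = \sum_(m <- d) scal phi@_m * word_eval r m.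
Proof.
move=> sd; rewrite /OPI_eval (big_fset_incl _ sd) //= => m _ /mcoeff_outdom ->.
by rewrite scal0 mul0r.
Qed.

Lemma eq_in_OPI_eval B (phi : {malg k[{bword X}]}) (r r' : X -> B) :
  (forall m x, m \in msupp phi -> inl x \in string m -> r x = r' x) ->
  OPI_eval phi r = OPI_eval phi r'.
Proof.
move=> rr'; apply: eq_big_seq => m mphi; congr (_ * _); rewrite !word_evalE.
by apply: eq_in_letters_eval => x; apply: rr'.
Qed.

Lemma OPI_eval_sum B (phi : {malg k[{bword X}]}) (r : X -> B) x
    (I : Type) (t : seq I) (c : I -> k) (b : I -> B) :
  (forall m, m \in msupp phi -> count_mem (inl x) (string m) = 1%N) ->
  OPI_eval phi (update r x (\sum_(i <- t) scal (c i) * b i)) =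
  \sum_(i <- t) scal (c i) * OPI_eval phi (update r x (b i)).
Proof.
move=> phi1; rewrite /OPI_eval.
under [RHS]eq_bigr do rewrite mulr_sumr.
rewrite exchange_big; apply: eq_big_seq => m /phi1 m1 /=.
rewrite word_evalE letters_eval_sum // mulr_sumr; apply: eq_bigr => i _.
by rewrite word_evalE !mulrA scal_central.
Qed.

Lemma letters_eval_morph B B' (h : B -> B') (r : X -> B) s : uOpAlg_morphism h ->
  h (letters_eval r s) = letters_eval (h \o r) s.
Proof.
move=> [[hz [h1 hM] hs] ho]; elim/letters_ind: s => [|x s IHs|v s IHv IHs].
- exact: h1.
- by rewrite !letters_eval_var hM IHs.
- by rewrite !letters_eval_br hM ho IHv IHs.
Qed.

Lemma uAlg_morphism_sum (B B' : uAlgType k) (h : B -> B') (I : Type) (t : seq I)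
    (c : I -> k) (b : I -> B) : uAlg_morphism h ->
  h (\sum_(i <- t) scal (c i) * b i) = \sum_(i <- t) scal (c i) * h (b i).
Proof.
move=> [hz [h1 hM] hs]; rewrite (zmod_morphism_sum hz).
by apply: eq_bigr => i _; rewrite hM hs.
Qed.

Lemma OPI_eval_morph B B' (h : B -> B') (phi : {malg k[{bword X}]}) (r : X -> B) :
  uOpAlg_morphism h -> h (OPI_eval phi r) = OPI_eval phi (h \o r).
Proof.
move=> hm; rewrite /OPI_eval uAlg_morphism_sum; last by case: hm.
by apply: eq_bigr => m _; rewrite !word_evalE letters_eval_morph.
Qed.

End Evaluation.

Section Words.
Variables (k : fieldType) (X Z : choiceType).
Local Notation kMZ := {malg k[{bword Z}]}.

Lemma scal_malg (c : k) (f : kMZ) : scal c * f = c *: f.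
Proof. exact: mul_malgC. Qed.

Lemma mul_word (u v : {bword Z}) : << u >> * << v >> = << mmul u v >> :> kMZ.
Proof. by rewrite malgM_def fgmulUU mulr1. Qed.

Lemma oper_word (u : {bword Z}) : oper << u >> = << bracket u >> :> kMZ.
Proof. exact: malg_liftU. Qed.

Lemma letters_eval_words (u : X -> {bword Z}) (s : seq (letter X)) :
  letters_eval (fun x => << u x >> : kMZ) s = << bsubst u (FMonom s) >>.
Proof.
elim/letters_ind: s => [|x s IHs|v s IHv IHs].
- by rewrite /letters_eval /= ; congr (<< _ >>); apply: val_inj; rewrite /= fm1.
- rewrite letters_eval_var IHs mul_word; congr (<< _ >>).
  by apply: bword_inj; rewrite string_mul !string_bsubst string_var_cons.
- rewrite letters_eval_br IHv IHs oper_word mul_word; congr (<< _ >>).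
  by apply: bword_inj; rewrite string_mul /= cats0.
Qed.

(** Substituting words for the variables is the linear extension of a map between
    monomials. *)
Lemma OPI_wordsE (phi : {malg k[{bword X}]}) (u : X -> {bword Z}) :
  OPI_words phi u = malg_lift (bsubst u) phi.
Proof.
apply: eq_bigr => m _; rewrite word_evalE letters_eval_words scal_malg.
by rewrite scale_monomial mulr1; case: m.
Qed.

End Words.

(** * Occurrences in strings *)

Section Occurrences.

Lemma cat_inside (T : Type) (L V R A g B : seq T) :
  L ++ V ++ R = A ++ g ++ B -> (size L <= size A)%N ->
  (size A + size g <= size L + size V)%N ->
  exists P Q, [/\ V = P ++ g ++ Q, A = L ++ P & B = Q ++ R].
Proof.
move=> E LA AV; have [P AE VE] := cat_le E LA.
have [|Q gE BE] := cat_le (esym (etrans VE (catA P g B))).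
  by rewrite size_cat; move: AV; rewrite AE size_cat; lia.
by exists P, Q; rewrite catA.
Qed.

(** Moving [V] from the place after [L0] to the place after [L] moves every
    occurrence of [g] in [V] to another one, by the same distance. The occurrences
    are finitely many, so the distance is zero. *)
Lemma occurrence_rigid (T : Type) (g V L R L0 R0 P0 Q0 : seq T) :
  V = P0 ++ g ++ Q0 -> L ++ V ++ R = L0 ++ V ++ R0 ->
  (forall A B, L0 ++ V ++ R0 = A ++ g ++ B ->
     (size L0 <= size A)%N /\ (size A + size g <= size L0 + size V)%N) ->
  size L = size L0.
Proof.
move=> V0 E inside.
have step P Q : V = P ++ g ++ Q ->
    exists P' Q', V = P' ++ g ++ Q' /\ (size L0 + size P' = size L + size P)%N.
  move=> VE; have E' : L0 ++ V ++ R0 = (L ++ P) ++ g ++ (Q ++ R).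
    by rewrite -E [in LHS]VE -!catA.
  have [le1 le2] := inside _ _ E'.
  have [P' [Q' [VE' LP _]]] := cat_inside E' le1 le2.
  by exists P', Q'; split=> //; have := congr1 size LP; rewrite !size_cat.
have bound P Q : V = P ++ g ++ Q -> (size P <= size V)%N.
  by move=> ->; rewrite size_cat leq_addr.
case: (ltngtP (size L) (size L0)) => // LL0; exfalso.
  have [n] := ubnP (size P0); elim: n P0 Q0 V0 => // n IHn P Q VE Pn.
  have [P' [Q' [VE' PP]]] := step P Q VE.
  by apply: (IHn P' Q' VE'); lia.
have [n] := ubnP (size V - size P0); elim: n P0 Q0 V0 => // n IHn P Q VE Pn.
have [P' [Q' [VE' PP]]] := step P Q VE.
by apply: (IHn P' Q' VE'); have := bound _ _ VE'; lia.
Qed.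

Lemma bracket_outside (Z : Type) (g : seq Z) b (L M A B : seq (Z + bool)) :
  L ++ inr b :: M = A ++ map inl g ++ B ->
  (size L < size A)%N \/ (size A + size g <= size L)%N.
Proof.
move=> E; case: (ltnP (size L) (size A)) => [|AL]; [by left | right].
have [C LE gE] := cat_le (esym E) AL.
rewrite LE size_cat leq_add2l leqNgt; apply/negP => Cg.
have [|D gD DE] := cat_le (esym gE); first by rewrite size_map ltnW.
case: D gD DE => [|d D] gD DE.
  by have := congr1 size gD; rewrite size_map cats0 => gC; rewrite gC ltnn in Cg.
have [a [e [_ _]]] := map_eq_cat gD; case: e => // z e [dz _].
by move: DE; rewrite dz.
Qed.

(** As [g] has no brackets and two variables of [t] are always separated by a
    bracket, an occurrence of [g] that meets the image of [t] meets the image of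
    one variable only; it can leave this image only at an end of [t]. *)
Lemma locate (X Z : Type) (sub : X -> seq (Z + bool)) (g : seq Z) t L R A B :
  (forall t1 x y t2, t <> t1 ++ inl x :: inl y :: t2) ->
  (0 < size t)%N -> (0 < size g)%N ->
  L ++ string_subst sub t ++ R = A ++ map inl g ++ B ->
  (size L < size A + size g)%N -> (size A < size L + size (string_subst sub t))%N ->
  exists t1 x t2, [/\ t = t1 ++ inl x :: t2,
    t1 = [::] \/ (size L + size (string_subst sub t1) <= size A)%N &
    t2 = [::] \/
    (size A + size g <= size L + size (string_subst sub t1) + size (sub x))%N].
Proof.
move=> sep + g0; elim: t L sep => // c t IHt L sep _; rewrite string_subst_cons -catA => E Lg At.
have septail t1 x y t2 : t <> t1 ++ inl x :: inl y :: t2.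
  by move=> tE; apply: (sep (c :: t1) x y t2); rewrite tE.
move: E Lg At; rewrite size_cat; case: c sep => [x|b] sep /= E Lg At; last first.
  case: (bracket_outside E) => [LA|]; last by lia.
  case: t IHt sep septail E At => [|c t] IHt sep septail E At; first by move: At => /=; lia.
  have [||||t1 [y [t2 [-> H1 H2]]]] := IHt (rcons L (inr b)) septail.
  - by [].
  - by rewrite cat_rcons.
  - by rewrite size_rcons; lia.
  - by rewrite size_rcons; lia.
  rewrite size_rcons in H1 H2; exists (inr b :: t1), y, t2; split=> //.
    right; rewrite string_subst_cons /=.
    by case: H1 => [->|] /=; lia.
  by case: H2 => [->|H2]; [left | right; rewrite string_subst_cons /=; lia].
case: t IHt sep septail E At => [|[y|b] t] IHt sep septail E At.
- by exists [::], x, [::]; split=> //; left.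
- by case: (sep [::] x y t).
case: (@bracket_outside _ g b (L ++ sub x) (string_subst sub t ++ R) A B).
- by rewrite -catA.
- rewrite size_cat => LA.
  have [||||t1 [y [t2 [tE H1 H2]]]] := IHt (L ++ sub x) septail.
  + by [].
  + by rewrite -catA.
  + by rewrite size_cat; lia.
  + by rewrite size_cat; lia.
  rewrite size_cat in H1 H2; exists (inl x :: t1), y, t2; split.
  + by rewrite tE.
  + case: H1 => [t10|H1]; first by rewrite t10 in tE.
    by right; rewrite string_subst_cons size_cat /=; lia.
  + by case: H2 => [->|H2]; [left | right; rewrite string_subst_cons size_cat /=; lia].
- rewrite size_cat => gL; exists [::], x, (inr b :: t); split; [by []|by left|right].
  by rewrite /= ; lia.
Qed.

(** A nest of brackets deeper than its surroundings can occur there at one place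
    only. *)
Lemma generic_size (Z : Type) n (L R L' R' : seq (Z + bool)) :
  let v := nseq n (inr true) ++ nseq n (inr false) in
  (size L < n)%N -> (size L' < n)%N ->
  L ++ v ++ R = L' ++ v ++ R' -> size L = size L'.
Proof.
move=> v; wlog LL' : L L' R R' / (size L <= size L')%N => [H Ln Ln' E|Ln Ln' E].
  have [LL'|LL'] := orP (leq_total (size L) (size L')); first exact: H E.
  by apply/esym; apply: H (esym E).
apply/eqP; rewrite eqn_leq LL' leqNgt; apply/negP => lt.
have [C LE vE] := cat_le E LL'; rewrite LE size_cat in LL' Ln' lt.
have n0 : (0 < n)%N by apply: leq_ltn_trans Ln.
have lhs : nth (inr true) (v ++ R) n = inr false.
  by rewrite /v -catA nth_cat size_nseq ltnn subnn nth_cat size_nseq n0 nth_nseq n0.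
have rhs : nth (inr true) (C ++ v ++ R') n = inr true.
  rewrite /v -catA nth_cat ltnNge; have -> /= : (size C <= n)%N by lia.
  rewrite nth_cat size_nseq; have -> : (n - size C < n)%N by lia.
  by rewrite nth_nseq if_same.
by move: lhs; rewrite vE rhs.
Qed.

End Occurrences.

(** * Instances of an identity with one varying variable *)

Lemma balanced_nseq (Z : Type) n :
  balanced (nseq n (inr true : Z + bool) ++ nseq n (inr false)).
Proof.
have open_n j : depth j (nseq n (inr true : Z + bool)) = Some (n + j)%N.
  by elim: n j => //= n IHn j; rewrite IHn addnS.
rewrite /balanced depth_cat open_n addn0 /=.
by elim: n {open_n}.
Qed.

Section Instances.
Variables (k : fieldType) (X Z : choiceType).
Implicit Types (u : X -> {bword Z}) (m : {bword X}) (v : {bword Z}) (x : X).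
Local Notation sub u := (fun x => string (u x : {bword Z})).

Lemma string_subst_update u x v (s : seq (X + bool)) : inl x \notin s ->
  string_subst (sub (update u x v)) s = string_subst (sub u) s.
Proof.
move=> xs; apply: eq_in_string_subst => y ys; rewrite /update; case: eqP => // yx.
by rewrite -yx ys in xs.
Qed.

Lemma count1_split (T : eqType) (c : T) s t :
  count_mem c (s ++ c :: t) = 1%N -> c \notin s /\ c \notin t.
Proof.
rewrite count_cat /= eqxx add1n addnS => -[] /eqP; rewrite addn_eq0.
by move=> /andP[s0 t0]; split; rewrite -has_pred1 has_count -eqn0Ngt.
Qed.

Lemma count1_split_uniq (T : eqType) (c : T) s t s' t' :
  count_mem c (s ++ c :: t) = 1%N -> s ++ c :: t = s' ++ c :: t' -> s = s' /\ t = t'.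
Proof.
move=> c1 E; have [cs _] := count1_split c1.
have [cs' _] : c \notin s' /\ c \notin t' by apply: count1_split; rewrite -E.
have ss : size s = size s'.
  by have := congr1 (index c) E; rewrite !index_cat (negPf cs) (negPf cs') /= eqxx !addn0.
by move/eqP: E; rewrite eqseq_cat // => /andP[/eqP -> /eqP[->]].
Qed.

Lemma context_update u x m t1 t2 : count_mem (inl x) (string m) = 1%N ->
  string m = t1 ++ inl x :: t2 -> exists q : starword Z,
    context q (string_subst (sub u) t1) (string_subst (sub u) t2) /\
    forall v, bsubst (update u x v) m = bplug q v.
Proof.
move=> m1 mE; have [xt1 xt2] : inl x \notin t1 /\ inl x \notin t2.
  by apply: count1_split; rewrite -mE.
have E v : string (bsubst (update u x v) m) =
    string_subst (sub u) t1 ++ string v ++ string_subst (sub u) t2.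
  rewrite string_bsubst mE string_subst_cat string_subst_cons /= /update eqxx.
  by rewrite !string_subst_update.
have [|q qc] := @context_of Z (string_subst (sub u) t1) (string_subst (sub u) t2).
  have := string_balanced (bsubst (update u x (FMonom [::])) m).
  by rewrite E.
by exists q; split=> // v; apply: bword_inj; rewrite E qc.
Qed.

Lemma update_id u x : update u x (u x) = u.
Proof. by apply/funext => y; rewrite /update; case: eqP => // ->. Qed.

Lemma instance_contexts (phi : {malg k[{bword X}]}) u x :
  (forall m, m \in msupp phi -> count_mem (inl x) (string m) = 1%N) ->
  exists q : {bword X} -> starword Z, forall m, m \in msupp phi ->
    forall v, bsubst (update u x v) m = bplug (q m) v.
Proof.
move=> phi1; suff /choice[q qE] : forall m, exists q : starword Z,
    m \in msupp phi -> forall v, bsubst (update u x v) m = bplug q v.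
  by exists q.
move=> m; have [mphi|mphi] := boolP (m \in msupp phi); last first.
  by have [q _] := context_id Z; exists q.
have : inl x \in string m by rewrite -has_pred1 has_count phi1.
case/splitPr mE : _ / => [t1 t2].
by have [q [_ qE]] := context_update u (phi1 _ mphi) mE; exists q.
Qed.

Lemma OPI_words_contexts (phi : {malg k[{bword X}]}) u x (q : {bword X} -> starword Z) :
  (forall m, m \in msupp phi -> forall v, bsubst (update u x v) m = bplug (q m) v) ->
  forall v, OPI_words phi (update u x v) = \sum_(m <- msupp phi) << phi@_m *g bplug (q m) v >>.
Proof.
move=> qE v; rewrite OPI_wordsE; apply: eq_big_seq => m mphi.
by rewrite qE.
Qed.

Variables (leX : rel {bword X}) (leZ : rel {bword Z}).
Variable phi : {malg k[{bword X}]}.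
Local Notation m0 := (lead leX phi).
Local Notation leadZ := (lead leZ).
Hypothesis lead_instances : forall u : X -> {bword Z},
  OPI_words phi u = 0 \/ leadZ (OPI_words phi u) = bsubst u m0.

Lemma OPI_words0 u : phi = 0 -> OPI_words phi u = 0.
Proof. by move=> ->; rewrite OPI_wordsE raddf0. Qed.

(** The sum is the coefficient of the leading word in the instance where [x] is a
    very deep nest [v] of brackets, for then the monomials of [phi] get distinct
    values unless their contexts agree. If it were zero, the instance at [v] would
    vanish by the hypothesis on the leading words, and with it all the instances,
    as images of that one. *)
Lemma generic_instance u x : OPI_words phi u != 0 ->
  (forall m, m \in msupp phi -> count_mem (inl x) (string m) = 1%N) ->
  forall q : {bword X} -> starword Z,
  (forall m, m \in msupp phi -> forall v, bsubst (update u x v) m = bplug (q m) v) ->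
  \sum_(m <- msupp phi) phi@_m *+ `[< bplug (q m) =1 bplug (q m0) >] != 0.
Proof.
move=> phiu phi1 q qE.
have phi0 : phi != 0 by apply: contraNneq phiu => /OPI_words0 ->.
have m0phi := lead_supp leX phi0.
have /choice[L qL] : forall m, exists L, exists R, context (q m) L R.
  by move=> m; apply: context_ex.
pose n := (\max_(m <- msupp phi) size (L m)).+1.
have Ln m : m \in msupp phi -> (size (L m) < n)%N.
  by move=> mphi; rewrite ltnS; apply: leq_bigmax_seq.
have [v vE] : exists v : seq (letter Z), nseq n (inr true) ++ nseq n (inr false) = string v.
  exact/balanced_string/balanced_nseq.
have gen m m' : m \in msupp phi -> m' \in msupp phi ->
    bplug (q m) (FMonom v) = bplug (q m') (FMonom v) -> bplug (q m) =1 bplug (q m').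
  move=> mphi mphi' E; have [[R qc] [R' qc']] := (qL m, qL m').
  apply: (context_size_inj qc qc' _ E).
  have := congr1 (fun w : {bword Z} => string w) E; rewrite qc qc' /= -vE.
  by apply: generic_size; apply: Ln.
have coefE w : (OPI_words phi (update u x w))@_(bplug (q m0) w) =
    \sum_(m <- msupp phi) phi@_m *+ (bplug (q m) w == bplug (q m0) w).
  rewrite (OPI_words_contexts qE) raddf_sum; apply: eq_bigr => m _ /=.
  exact: mcoeffU.
have {}coefE : (OPI_words phi (update u x (FMonom v)))@_(bplug (q m0) (FMonom v)) =
    \sum_(m <- msupp phi) phi@_m *+ `[< bplug (q m) =1 bplug (q m0) >].
  rewrite coefE; apply: eq_big_seq => m mphi; congr (_ *+ nat_of_bool _).
  by apply/eqP/asboolP => [|->//]; apply: gen.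
rewrite -coefE; have [F0|Fn0] := eqVneq (OPI_words phi (update u x (FMonom v))) 0.
  case/eqP: phiu; rewrite -(update_id u x).
  have /choice[h hE] : forall w, exists w', forall m, m \in msupp phi ->
      bplug (q m) (FMonom v) = w -> bplug (q m) (u x) = w'.
    move=> w; have [[m [mphi mw]]|no] :=
        pselect (exists m, m \in msupp phi /\ bplug (q m) (FMonom v) = w).
      by exists (bplug (q m) (u x)) => m' mphi' mw'; apply: gen; rewrite ?mw.
    by exists w => m mphi mw; case: no; exists m.
  transitivity (malg_lift h (OPI_words phi (update u x (FMonom v)))).
    rewrite !(OPI_words_contexts qE) raddf_sum.
    by apply: eq_big_seq => m mphi /=; rewrite malg_liftU -(hE _ m).
  by rewrite F0 raddf0.
case: (lead_instances (update u x (FMonom v))) => [/eqP|leadF]; first by rewrite (negPf Fn0).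
by rewrite -(qE _ m0phi) -leadF; apply: lcoef_neq0.
Qed.

End Instances.

(** * A word inside the value of a variable *)

Lemma cancel_top (k : fieldType) (V : lmodType k) (c d : k) (f y e r : V) :
  c != 0 -> d != 0 -> e = d *: f + r ->
  c^-1 *: f - d^-1 *: y = (c * d)^-1 *: (e - c *: y - r).
Proof.
move=> c0 d0 ->; rewrite addrAC addrK scalerBr !scalerA invfM.
by rewrite mulfVK // mulrAC mulVf // mul1r.
Qed.

Lemma mcoeff_combination (k : fieldType) (K : choiceType) (f g h : {malg k[K]}) a b w :
  (a *: f + g - b *: h)@_w = a * f@_w + g@_w - b * h@_w.
Proof. by rewrite mcoeffB mcoeffD !mcoeffZ. Qed.

Section Mixed.
Variables (k : fieldType) (X Z : choiceType).
Implicit Types (u : X -> {bword Z}) (m : {bword X}) (v w : {bword Z}) (x : X).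
Implicit Types (q : starword Z).
Local Notation sub u := (fun x => string (u x : {bword Z})).
Variables (leX : rel {bword X}) (leZ : rel {bword Z}).
Hypothesis leZ_order : monomial_order (@bplug Z) leZ.
Local Notation lt u v := (leZ u v && (u != v)).
Local Notation leadZ := (lead leZ).

Section OneIdentity.
Variable phi : {malg k[{bword X}]}.
Local Notation m0 := (lead leX phi).
Hypothesis lead_instances : forall u : X -> {bword Z},
  OPI_words phi u = 0 \/ leadZ (OPI_words phi u) = bsubst u m0.
Hypothesis no_adjacent : forall t1 x y t2, string m0 <> t1 ++ inl x :: inl y :: t2.

Local Notation linear_in x :=
  (forall m, m \in msupp phi -> count_mem (inl x) (string m) = 1%N).

Lemma lead_instance u : OPI_words phi u != 0 -> leadZ (OPI_words phi u) = bsubst u m0.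
Proof. by move=> u0; case: (lead_instances u) => // u1; rewrite u1 eqxx in u0. Qed.

(** An instance can vanish by accident, because different monomials get equal
    values. This is excluded here: all the occurrences of [g] in the leading word
    are inside [v], so that by [occurrence_rigid] no monomial with another context
    has the same value, and the coefficient of the leading word is that of
    [generic_instance]. *)
Lemma instance_neq0 u x (g : seq Z) v P Q : linear_in x -> (0 < size g)%N ->
  string v = P ++ map inl g ++ Q ->
  (forall y, y <> x -> inl y \in string m0 ->
     forall P Q, string (u y) <> P ++ map inl g ++ Q) ->
  OPI_words phi u != 0 -> OPI_words phi (update u x v) != 0.
Proof.
move=> phi1 g0 vE ug phiu.
have phi0 : phi != 0 by apply: contraNneq phiu => /OPI_words0 ->.
have m0phi := lead_supp leX phi0.
have [q qE] := instance_contexts u phi1.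
apply/eqP => F0; case/eqP: (generic_instance lead_instances phiu phi1 qE).
transitivity ((OPI_words phi (update u x v))@_(bplug (q m0) v)); last first.
  by rewrite F0 mcoeff0.
rewrite (OPI_words_contexts qE) raddf_sum /=; apply: eq_big_seq => m mphi.
rewrite mcoeffU; congr (_ *+ nat_of_bool _).
apply/asboolP/eqP => [-> //|mm0].
have : inl x \in string m0 by rewrite -has_pred1 has_count phi1.
case/splitPr m0E : _ / => [t1 t2].
have [q0 [q0c q0E]] := context_update u (phi1 _ m0phi) m0E.
have c0 : context (q m0) (string_subst (sub u) t1) (string_subst (sub u) t2).
  by move=> w; rewrite -(qE _ m0phi) q0E q0c.
have [L [R c]] := context_ex (q m).
apply: (context_size_inj c c0 _ mm0).
have := congr1 (fun w : {bword Z} => string w) mm0; rewrite c c0.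
move=> E0; apply: (occurrence_rigid vE E0) => A B E.
have m01 := phi1 _ m0phi; rewrite m0E in m01.
have [xt1 xt2] := count1_split m01.
have subE : string_subst (sub (update u x v)) (string m0) =
    string_subst (sub u) t1 ++ string v ++ string_subst (sub u) t2.
  rewrite m0E string_subst_cat string_subst_cons /= {2}/update eqxx.
  by rewrite !string_subst_update.
have sizeE := congr1 size E; rewrite !size_cat size_map in sizeE.
have [||||s1 [y [s2 [sE H1 H2]]]] :=
    @locate _ _ (sub (update u x v)) g (string m0) [::] [::] A B no_adjacent _ g0.
- by rewrite m0E size_cat /= addnS.
- by rewrite cats0 /= subE.
- by rewrite addn_gt0 g0 orbT.
- by rewrite subE !size_cat /=; lia.
have [yx|yx] := pselect (y = x).
  move: sE H1 H2; rewrite m0E yx => /(count1_split_uniq m01)[<- <-].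
  rewrite !string_subst_update // /update eqxx => H1 H2; split.
    by case: H1 => [->|].
  rewrite size_map; case: H2 => [t20|H2]; last by move: H2; rewrite /=; lia.
  by move: sizeE; rewrite t20 /=; lia.
exfalso.
have E' : string_subst (sub (update u x v)) s1 ++ string (u y) ++
    string_subst (sub (update u x v)) s2 = A ++ map inl g ++ B.
  rewrite -E -subE sE string_subst_cat string_subst_cons /=.
  by congr (_ ++ (_ ++ _)); rewrite /update; case: eqP.
have uyE : string (update u x v y) = string (u y) by rewrite /update; case: eqP.
rewrite uyE in H2.
have sizeE' := congr1 size E'; rewrite !size_cat size_map in sizeE'.
have [||P' [Q' [E'' _ _]]] := cat_inside E'.
- by case: H1 => [->|] //=; lia.
- rewrite size_map; case: H2 => [s20|H2]; last by move: H2; rewrite /=; lia.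
  by move: sizeE'; rewrite s20 /=; lia.
apply: (ug y yx _ P' Q' E'').
by rewrite sE mem_cat mem_head orbT.
Qed.

(** Let [F v] be the instance of [phi] in which [v] replaces the leading word of [s]
    inside [u x], extended linearly to [F s]. Then [F s] is on the one hand a
    combination of instances whose top term is the given one, on the other hand a
    sum [E] of elements [q|_s], one for each monomial of [phi]. Subtract from [E]
    the element [q|_s] with the leading word of the instance: the rest is in the
    span of the elements [q|_s], for [s] in [SG], and below that word. Its terms may
    exceed the word and cancel; the diamond lemma for [SG] replaces them by smaller
    ones. *)
Lemma nested_resolved (SPhi SG S : set {malg k[{bword Z}]}) u x p s :
  (forall u, SPhi (OPI_words phi u)) -> SPhi `<=` S -> SG `<=` S ->
  confluent (@bplug Z) leZ SG -> SG s -> s != 0 -> linear_in x ->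
  u x = bplug p (leadZ s) -> OPI_words phi u != 0 ->
  exists q, bplug q (leadZ s) = leadZ (OPI_words phi u) /\
    combination (@bplug Z) leZ S (fun v => lt v (leadZ (OPI_words phi u)))
      (((OPI_words phi u)@_(leadZ (OPI_words phi u)))^-1 *: OPI_words phi u
       - (s@_(leadZ s))^-1 *: malg_lift (bplug q) s).
Proof.
move=> SPhiP SPhiS SGS confG SGs s0 phi1 uxE phiu.
have phi0 : phi != 0 by apply: contraNneq phiu => /OPI_words0 ->.
have m0phi := lead_supp leX phi0.
have [q' qE'] := instance_contexts u phi1.
have /choice[q qq] : forall m, exists q, bplug q =1 bplug (q' m) \o bplug p.
  by move=> m; apply: context_comp.
have qE m v : m \in msupp phi -> bsubst (update u x (bplug p v)) m = bplug (q m) v.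
  by move=> mphi; rewrite qE' // qq.
pose F v := OPI_words phi (update u x (bplug p v)).
have FE v : F v = \sum_(m <- msupp phi) << phi@_m *g bplug (q m) v >>.
  by rewrite /F OPI_wordsE; apply: eq_big_seq => m mphi; rewrite qE.
have Fs : F (leadZ s) = OPI_words phi u by rewrite /F -uxE update_id.
have leadF v : F v != 0 -> leadZ (F v) = bplug (q m0) v.
  by move=> Fv0; rewrite -(qE _ _ m0phi); apply: lead_instance Fv0.
have SF v : S (F v) by apply/SPhiS/SPhiP.
move: phiu; rewrite -Fs; clearbody F => F0; rewrite (leadF _ F0).
exists (q m0); split; first by [].
pose W := bplug (q m0) (leadZ s).
pose E : {malg k[{bword Z}]} := \sum_(m <- msupp phi) phi@_m *: malg_lift (bplug (q m)) s.
pose D : {malg k[{bword Z}]} := \sum_(v <- (msupp s `\ leadZ s)%fset) s@_v *: F v.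
have EE : E = s@_(leadZ s) *: F (leadZ s) + D.
  transitivity (\sum_(v <- msupp s) s@_v *: F v).
    under [RHS]eq_bigr => v _ do rewrite FE scaler_sumr.
    rewrite exchange_big; apply: eq_bigr => m _ /=; rewrite scaler_sumr.
    by apply: eq_bigr => v _; rewrite !scale_monomial mulrC.
  by rewrite (big_fsetD1 _ (lead_supp leZ s0)).
have DS : combination (@bplug Z) leZ S (fun v => lt v W) D.
  apply: combination_sum => v; rewrite in_fsetD1 => /andP[vN vs]; apply: combinationZ.
  have [->|Fv0] := eqVneq (F v) 0; first exact: Comb0.
  have [q1 q1E] := context_id Z.
  rewrite -[F v]malg_lift_id -(eq_malg_lift q1E); apply: combination1.
    exact: SF.
  by rewrite q1E /= leadF //; apply/(plug_lt leZ_order)/(lt_supp leZ_order).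
have EG : combination (@bplug Z) leZ SG (fun=> True) E.
  by apply: combination_sum => m _; apply/combinationZ/combination1.
clearbody E D.
pose R : {malg k[{bword Z}]} := E - (F (leadZ s))@_W *: malg_lift (bplug (q m0)) s.
have RG : combination (@bplug Z) leZ SG (fun=> True) R.
  by apply: combinationB => //; apply/combinationZ/combination1.
have RE w : R@_w = s@_(leadZ s) * (F (leadZ s))@_w + D@_w
    - (F (leadZ s))@_W * (malg_lift (bplug (q m0)) s)@_w.
  by rewrite /R EE mcoeff_combination.
have Rlt w : w \in msupp R -> lt w W.
  apply: contraTT => wW; rewrite -mcoeff_eq0 RE.
  have -> : D@_w = 0.
    apply: mcoeff_outdom; apply: contra wW => /(combination_supp leZ_order DS)[v vW wv].
    exact: (mle_lt_trans leZ_order wv vW).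
  have [->|wNW] := eqVneq w W; first by rewrite (mcoeff_plug leZ_order) addr0 mulrC subrr.
  have -> : (F (leadZ s))@_w = 0.
    apply: mcoeff_outdom; apply: contra wW => /(lead_ge leZ_order).
    by rewrite leadF // wNW => ->.
  have -> : (malg_lift (bplug (q m0)) s)@_w = 0.
    apply: mcoeff_outdom; apply: contra wW => /(msupp_plug leZ_order).
    by rewrite wNW => ->.
  by rewrite !mulr0 addr0 subr0.
have RS : combination (@bplug Z) leZ S (fun v => lt v W) R.
  have [->|R0] := eqVneq R 0; first exact: Comb0.
  have [RSG _] := diamond leZ_order confG RG R0.
  apply: combinationS RSG => // v vR.
  exact: (mle_lt_trans leZ_order vR (Rlt _ (lead_supp leZ R0))).
have c0 : (F (leadZ s))@_W != 0 by rewrite /W -leadF // lcoef_neq0.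
rewrite (cancel_top _ c0 (lcoef_neq0 leZ s0) EE).
by apply/combinationZ/combinationB.
Qed.

End OneIdentity.
End Mixed.

(** * Critical pairs of an identity and a word *)

Section MixedPairs.
Variables (k : fieldType) (X Z : choiceType).
Implicit Types (u : X -> {bword Z}) (m : {bword X}) (v w : {bword Z}) (x : X).
Implicit Types (q : starword Z).
Local Notation sub u := (fun x => string (u x : {bword Z})).
Variables (leX : rel {bword X}) (leZ : rel {bword Z}).
Hypothesis leZ_order : monomial_order (@bplug Z) leZ.
Local Notation lt u v := (leZ u v && (u != v)).
Local Notation leadZ := (lead leZ).
Variable phi : {malg k[{bword X}]}.
Local Notation m0 := (lead leX phi).
Hypothesis lead_instances : forall u : X -> {bword Z},
  OPI_words phi u = 0 \/ leadZ (OPI_words phi u) = bsubst u m0.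
Hypothesis no_adjacent : forall t1 x y t2, string m0 <> t1 ++ inl x :: inl y :: t2.
Hypothesis m0_linear : forall x, inl x \in string m0 ->
  forall m, m \in msupp phi -> count_mem (inl x) (string m) = 1%N.
Hypothesis m0_neq1 : (0 < size (string m0))%N.
Variables SPhi SG S : set {malg k[{bword Z}]}.
Hypothesis SPhiP : forall u, SPhi (OPI_words phi u).
Hypothesis SPhiS : SPhi `<=` S.
Hypothesis SGS : SG `<=` S.
Hypothesis SG_confluent : confluent (@bplug Z) leZ SG.

Definition normalized q (s : {malg k[{bword Z}]}) : {malg k[{bword Z}]} :=
  (s@_(leadZ s))^-1 *: malg_lift (bplug q) s.

Local Notation combS w := (combination (@bplug Z) leZ S (fun v => lt v w)).

Lemma nested_normalized q u x p s : SG s -> s != 0 ->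
  inl x \in string m0 -> u x = bplug p (leadZ s) -> OPI_words phi u != 0 ->
  exists q', bplug q' (leadZ s) = bplug q (leadZ (OPI_words phi u)) /\
    combS (bplug q (leadZ (OPI_words phi u)))
      (normalized q (OPI_words phi u) - normalized q' s).
Proof.
move=> SGs s0 xm0 uxE phiu.
have [q0 [q0E]] := nested_resolved leZ_order lead_instances SPhiP SPhiS SGS
  SG_confluent SGs s0 (m0_linear xm0) uxE phiu.
rewrite /normalized.
move: (OPI_words phi u) q0E => f q0E.
move=> /(combination_plug (@context_comp Z q)).
move=> /(_ (fun v => lt v (bplug q (leadZ f)))
           (fun v => @plug_lt _ _ _ _ leZ_order q v _)).
have [q' q'E] := context_comp q q0.
rewrite malg_lift_subZ malg_lift_comp -(eq_malg_lift q'E) => H.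
by exists q'; rewrite q'E /= q0E.
Qed.

(** The pair that is resolved may differ from the given one, since pairs inside
    [SPhi] and inside [SG] are resolved anyway. When the bracket-free word overlaps
    the instance of [phi], [locate] gives the variable [x] whose value it meets;
    the rest of it is absorbed into the value of [x], which gives an instance with
    a leading word that contains it. If that instance vanishes, [instance_neq0]
    shows that the bracket-free word already occurs in the value of another
    variable. *)
Lemma mixed_resolved q1 u q2 s g : SG s -> s != 0 -> leadZ s = word_bword g ->
  OPI_words phi u != 0 -> bplug q1 (leadZ (OPI_words phi u)) = bplug q2 (leadZ s) ->
  exists q1' u' q2', [/\ OPI_words phi u' != 0,
    bplug q1' (leadZ (OPI_words phi u')) = bplug q2 (leadZ s),
    bplug q2' (leadZ s) = bplug q2 (leadZ s) &
    combS (bplug q2 (leadZ s))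
      (normalized q1' (OPI_words phi u') - normalized q2' s)].
Proof.
move=> SGs s0 sE phiu; set w := bplug q2 (leadZ s) => wE1.
have wE2 : bplug q2 (leadZ s) = w by [].
have [L1 [R1 c1]] := context_ex q1; have [L2 [R2 c2]] := context_ex q2.
have Sf : S (OPI_words phi u) by apply/SPhiS/SPhiP.
have Ss : S s by apply: SGS.
have leadE := lead_instance lead_instances phiu.
have gE : string (leadZ s) = map inl g by rewrite sE string_word.
have E : L1 ++ string (leadZ (OPI_words phi u)) ++ R1 = L2 ++ map inl g ++ R2.
  by rewrite -c1 -gE -c2 wE1.
have disjoint M : L2 = L1 ++ string (leadZ (OPI_words phi u)) ++ M ->
    R1 = M ++ string (leadZ s) ++ R2 ->
    combS w (normalized q1 (OPI_words phi u) - normalized q2 s).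
  move=> L2E R1E; rewrite -wE1 /normalized -!malg_lift_scalable.
  by apply: (@disjoint_resolved _ _ _ leZ_order S q1 _ q2 s L1 M R2);
    rewrite -?R1E -?L2E.
have disjoint' q L M : L1 = L ++ string (leadZ s) ++ M ->
    context q L (M ++ string (leadZ (OPI_words phi u)) ++ R1) ->
    bplug q (leadZ s) = w /\
    combS w (normalized q1 (OPI_words phi u) - normalized q s).
  move=> L1E qc; have qE : bplug q (leadZ s) = w.
    by apply: bword_inj; rewrite qc -wE1 c1 L1E -!catA.
  split=> //; rewrite -qE -[_ - _]opprB -scaleN1r; apply: combinationZ.
  rewrite /normalized -!malg_lift_scalable.
  by apply: (@disjoint_resolved _ _ _ leZ_order S q s q1 _ L M R1); rewrite -?L1E.
(* The empty word occurs in front of everything. *)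
have [g0|g0] := posnP (size g).
  have gs : string (leadZ s) = [::] by rewrite gE (size0nil g0).
  have [|q qc] := @context_of _ [::] (L1 ++ string (leadZ (OPI_words phi u)) ++ R1).
    by rewrite -c1; apply: string_balanced.
  have L1gs : L1 = [::] ++ string (leadZ s) ++ L1 by rewrite gs.
  have [qE res] := disjoint' q [::] L1 L1gs qc.
  by exists q1, u, q.
have [gL1|L1g] := leqP (size L2 + size g) (size L1).
  have [|M L1E _] := cat_le (esym (etrans E (catA _ _ _))); first by rewrite size_cat size_map.
  rewrite -catA -gE in L1E.
  have [|qE res] := disjoint' q2 L2 M L1E.
    move=> v; rewrite c2; congr (_ ++ (_ ++ _)).
    by move: E; rewrite L1E gE -!catA => /eqP; rewrite !eqseq_cat // !eqxx => /eqP.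
  by exists q1, u, q2.
have [fL2|L2f] := leqP (size L1 + size (string (leadZ (OPI_words phi u)))) (size L2).
  have [|M L2E R1E] := cat_le (etrans (esym (catA _ _ _)) E); first by rewrite size_cat.
  rewrite -catA in L2E; rewrite -gE in R1E.
  by exists q1, u, q2; split=> //; apply: (disjoint M).
have fE : string (leadZ (OPI_words phi u)) = string_subst (sub u) (string m0).
  by rewrite leadE string_bsubst.
rewrite fE in E L2f.
have [t1 [x [t2 [m0E H1 H2]]]] := locate no_adjacent m0_neq1 g0 E L1g L2f.
have xm0 : inl x \in string m0 by rewrite m0E mem_cat mem_head orbT.
have EE : L1 ++ string_subst (sub u) t1 ++ string (u x) ++
    string_subst (sub u) t2 ++ R1 = L2 ++ map inl g ++ R2.
  by rewrite -E m0E string_subst_cat string_subst_cons -!catA.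
have sizeE := congr1 size EE; rewrite !size_cat size_map in sizeE.
have [L [a [L1E at1 Lle]]] : exists L (a : seq Z), [/\ L1 = L ++ map inl a,
    a = [::] \/ t1 = [::] & (size L + size (string_subst (sub u) t1) <= size L2)%N].
  have [L12|L21] := leqP (size L1 + size (string_subst (sub u) t1)) (size L2).
    by exists L1, [::]; rewrite cats0; split=> //; left.
  case: H1 => [t10|]; last by rewrite leqNgt L21.
  rewrite t10 /= addn0 in L21.
  have [C L1E gR] := cat_le (esym EE) (ltnW L21).
  have [|D gD _] := cat_le (esym gR).
    by move: L1g; rewrite L1E size_cat size_map; lia.
  have [a [d [_ CE _]]] := map_eq_cat gD.
  by exists L2, a; rewrite -CE t10 addn0; split=> //; right.
have [R [b [R1E bt2 Rle]]] : exists R (b : seq Z), [/\ R1 = map inl b ++ R,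
    b = [::] \/ t2 = [::] & (size R + size (string_subst (sub u) t2) <= size R2)%N].
  have [R12|R21] := leqP (size R1 + size (string_subst (sub u) t2)) (size R2).
    by exists R1, [::]; split=> //; left.
  case: H2 => [t20|]; last by lia.
  rewrite t20 /= addn0 in R21 sizeE.
  have EE' : (L1 ++ string_subst (sub u) t1 ++ string (u x)) ++ R1 = (L2 ++ map inl g) ++ R2.
    by rewrite -!catA -EE t20.
  have [|C L2E R1E] := cat_le EE'; first by rewrite !size_cat size_map; lia.
  have [|D _ gD] := cat_le L2E.
    by move: L2f; rewrite m0E t20 string_subst_cat string_subst_cons cats0 /= !size_cat; lia.
  have [d [b [_ _ CE]]] := map_eq_cat gD.
  by exists R2, b; rewrite -CE t20 addn0; split=> //; right.
have find_context t : (exists P Q, string (t : {bword Z}) = P ++ map inl g ++ Q) ->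
    exists p, t = bplug p (leadZ s).
  case=> P [Q tE]; have [|p pc] := @context_of _ P Q.
    have := string_balanced t; rewrite tE -gE => /balanced_insert; apply.
    exact: string_balanced.
  by exists p; apply: bword_inj; rewrite pc gE.
have [[y [yx [ym0 /find_context[p uyE]]]]|no_y] := pselect (exists y, y <> x /\
    (inl y \in string m0 /\ exists P Q, string (u y) = P ++ map inl g ++ Q)).
  have [q [qE res]] := nested_normalized q1 SGs s0 ym0 uyE phiu.
  by exists q1, u, q; rewrite -wE1.
pose v := mmul (mmul (word_bword (FMonom a)) (u x)) (word_bword (FMonom b)).
have vE : string v = map inl a ++ string (u x) ++ map inl b.
  by rewrite !string_mul !string_word -catA.
have wE : (L ++ string_subst (sub u) t1) ++ string v ++ string_subst (sub u) t2 ++ R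
    = L2 ++ map inl g ++ R2.
  by rewrite -EE L1E R1E vE; case: at1 => ->; case: bt2 => ->; rewrite /= ?cats0 -?catA.
have sizewE := congr1 size wE; rewrite !size_cat size_map in sizewE.
have [||P [Q [vPQ _ _]]] := cat_inside wE.
- by rewrite size_cat.
- by rewrite size_map size_cat; lia.
have [p vp] := find_context v (ex_intro _ P (ex_intro _ Q vPQ)).
have phiv : OPI_words phi (update u x v) != 0.
  refine (instance_neq0 lead_instances no_adjacent (m0_linear xm0) g0 vPQ _ phiu).
  by move=> y yx ym0 P' Q' uyE; case: no_y; exists y; split=> //; split=> //; exists P', Q'.
have m01 : count_mem (inl x) (string m0) = 1%N.
  apply: (m0_linear xm0); apply: lead_supp.
  by apply: contraNneq phiu => /OPI_words0 ->.
have [xt1 xt2] := count1_split (etrans (congr1 (count_mem (inl x)) (esym m0E)) m01).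
have leadvE : string (leadZ (OPI_words phi (update u x v))) =
    string_subst (sub u) t1 ++ string v ++ string_subst (sub u) t2.
  rewrite (lead_instance lead_instances phiv) string_bsubst m0E string_subst_cat.
  by rewrite string_subst_cons !string_subst_update //= /update eqxx.
have wE' : string w = L ++ string (leadZ (OPI_words phi (update u x v))) ++ R.
  by rewrite c2 gE -wE leadvE -!catA.
have [|q qc] := @context_of _ L R.
  have := string_balanced w; rewrite wE' => /balanced_insert; apply.
  exact: string_balanced.
have qw : bplug q (leadZ (OPI_words phi (update u x v))) = w.
  by apply: bword_inj; rewrite qc wE'.
have uxE : update u x v x = bplug p (leadZ s) by rewrite /update eqxx.
have [q' [q'E res]] := nested_normalized q SGs s0 xm0 uxE phiv.
by exists q, (update u x v), q'; rewrite q'E qw in res *.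
Qed.

End MixedPairs.

(** * Confluence of the union *)

Lemma confluent_normalized (k : fieldType) (Z : choiceType) (leZ : rel {bword Z})
    (S T : set {malg k[{bword Z}]}) q s q' s' w :
  confluent (@bplug Z) leZ S -> S `<=` T -> S s -> S s' -> s != 0 -> s' != 0 ->
  bplug q (lead leZ s) = w -> bplug q' (lead leZ s') = w ->
  combination (@bplug Z) leZ T (fun v => leZ v w && (v != w))
    (normalized leZ q s - normalized leZ q' s').
Proof.
move=> conf ST Ss Ss' s0 s0' <- qq'.
exact: combinationS ST (fun _ => id) (conf _ _ _ _ Ss Ss' s0 s0' (esym qq')).
Qed.

Section Union.
Variables (k : fieldType) (X Z : choiceType) (Phi : set {malg k[{bword X}]}).
Hypothesis Phi_multilinear : forall phi, Phi phi -> multilinear_OPI phi.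
Variables (leX : rel {bword X}) (leZ : rel {bword Z}).
Hypothesis leZ_order : monomial_order (@bplug Z) leZ.
Hypothesis Phi_GS : GS_basis (@bplug Z) leZ (OPI_instances Phi Z).
Variable G : set {malg k[{fmonom Z}]}.
Hypothesis G_GS : GS_basis (@wplug Z) (relpre (@word_bword Z) leZ) G.
Hypothesis lead_no_subword : forall phi, Phi phi ->
  forall v : {fmonom X}, (1 < breadth v)%N ->
  ~ subword (word_bword v) (lead leX phi).
Hypothesis lead_instances : forall phi, Phi phi -> forall u : X -> {bword Z},
  OPI_words phi u = 0 \/
  lead leZ (OPI_words phi u) = bsubst u (lead leX phi).
Local Notation incl := (malg_lift (@word_bword Z)).
Local Notation S := (OPI_instances Phi Z `|` incl @` G).

Lemma union_confluent : confluent (@bplug Z) leZ S.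
Proof.
have conf_Phi := GS_confluent leZ_order Phi_GS.
have conf_G := GS_confluent leZ_order (GS_basis_incl leZ_order G_GS).
have PhiS : OPI_instances Phi Z `<=` S by move=> s; left.
have GS : incl @` G `<=` S by move=> s; right.
have mixed q s q' s' : OPI_instances Phi Z s -> (incl @` G) s' -> s != 0 -> s' != 0 ->
    bplug q (lead leZ s) = bplug q' (lead leZ s') ->
    combination (@bplug Z) leZ S
      (fun v => leZ v (bplug q' (lead leZ s')) && (v != bplug q' (lead leZ s')))
      (normalized leZ q s - normalized leZ q' s').
  move=> Phis Gs' s0 s0' qq'.
  have [phi [u [Pphi sE]]] := Phis.
  have [g Gg s'E] := Gs'.
  have phi0 : phi != 0 by apply: contraNneq s0; rewrite sE => /OPI_words0 ->.
  have m0phi := lead_supp leX phi0.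
  have [xs [xs0 _ occxs]] := Phi_multilinear Pphi.
  have no_adjacent t1 x y t2 : string (lead leX phi) <> t1 ++ inl x :: inl y :: t2.
    move=> m0E; apply: (lead_no_subword Pphi (v := FMonom [:: x; y])) => //.
    have [|p pc] := @context_of _ t1 t2.
      have := string_balanced (lead leX phi); rewrite m0E -[_ :: _ :: _]/([:: inl x; inl y] ++ t2).
      by move=> /balanced_insert; apply; apply: (string_balanced [:: Var x; Var y]).
    by exists p; apply: bword_inj; rewrite pc.
  have linear x : inl x \in string (lead leX phi) ->
      forall m, m \in msupp phi -> count_mem (inl x) (string m) = 1%N.
    move=> xm0 m mphi; rewrite -occE occxs //.
    have := occxs _ m0phi x; rewrite occE; case: (x \in xs) => // /eqP.
    by rewrite eqn0Ngt -has_count has_pred1 xm0.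
  have m0_gt0 : (0 < size (string (lead leX phi)))%N.
    case: xs xs0 occxs => // x xs _ /(_ _ m0phi x); rewrite occE mem_head.
    by case: (string _).
  have SPhiP v : OPI_instances Phi Z (OPI_words phi v).
    exact: (ex_intro _ phi (ex_intro _ v (conj Pphi erefl))).
  have leadE : lead leZ s' = word_bword (lead (relpre (@word_bword Z) leZ) g).
    by rewrite -s'E lead_incl.
  have phiu : OPI_words phi u != 0 by rewrite -sE.
  rewrite sE in qq'.
  have [q1 [u1 [q2 [phiu1 q1E q2E res]]]] := mixed_resolved leZ_order
    (lead_instances Pphi) no_adjacent linear m0_gt0 SPhiP PhiS GS conf_G
    Gs' s0' leadE phiu qq'.
  have r1 := confluent_normalized conf_Phi PhiS (SPhiP u) (SPhiP u1) phiu phiu1 qq' q1E.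
  have r2 := confluent_normalized conf_G GS Gs' Gs' s0' s0' q2E erefl.
  rewrite sE; move: r1 res r2; move: (normalized leZ q _) (normalized leZ q1 _).
  move: (normalized leZ q2 _) (normalized leZ q' _) => n2 n' n n1 r1 res r2.
  have -> : n - n' = (n - n1) + ((n1 - n2) + (n2 - n')) by rewrite subrKA subrKA.
  exact: combinationD r1 (combinationD res r2).
move=> q s q' s' [Phis|Gs] [Phis'|Gs'] s0 s0' qq'.
- exact: combinationS PhiS (fun _ => id) (conf_Phi _ _ _ _ Phis Phis' s0 s0' qq').
- by have := mixed q s q' s' Phis Gs' s0 s0' qq'; rewrite -qq'.
- have := mixed q' s' q s Phis' Gs s0' s0 (esym qq').
  by move=> /(combinationZ (-1)); rewrite scaleN1r opprB.
- exact: combinationS GS (fun _ => id) (conf_G _ _ _ _ Gs Gs' s0 s0' qq').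
Qed.

End Union.

(** * The operated ideal *)

Section Ideals.
Variables (k : fieldType) (Z : choiceType) (leZ : rel {bword Z}).
Local Notation kMZ := {malg k[{bword Z}]}.
Implicit Types (f g s : kMZ) (S : set kMZ) (u v w : {bword Z}) (q : starword Z).
Local Notation incl := (malg_lift (@word_bword Z)).
Local Notation comb S := (combination (@bplug Z) leZ S (fun=> True)).

Lemma incl_mul (f g : {malg k[{fmonom Z}]}) : incl (f * g) = incl f * incl g.
Proof.
rewrite [f in f * g]monalgE mulr_suml raddf_sum /= [incl f]/malg_lift mulr_suml.
apply: eq_bigr => v _.
rewrite (mull_monomialZ _ _ g) (mull_monomialZ _ _ (incl g)).
rewrite malg_lift_scalable !malg_lift_comp; congr (_ *: _).
by apply: eq_malg_lift => w /=; rewrite word_bword_mul.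
Qed.

Lemma combination_context S q f : comb S f -> comb S (malg_lift (bplug q) f).
Proof. exact: combination_plug (@context_comp Z q) _. Qed.

Lemma combination_mull S a f : comb S f -> comb S (a * f).
Proof.
move=> fS; rewrite [a]monalgE mulr_suml; apply: combination_sum => v _.
rewrite mull_monomialZ; apply: combinationZ.
have [q qE] := context_mul v (FMonom [::]).
rewrite (@eq_malg_lift _ _ _ _ (bplug q)); last first.
  by move=> w; rewrite qE; apply: bword_inj; rewrite !string_mul cats0.
exact: combination_context.
Qed.

Lemma combination_mulr S a f : comb S f -> comb S (f * a).
Proof.
move=> fS; rewrite [a]monalgE mulr_sumr; apply: combination_sum => v _.
rewrite mulr_monomialZ; apply: combinationZ.
have [q qE] := context_mul (FMonom [::]) v.
rewrite (@eq_malg_lift _ _ _ _ (bplug q)); last first.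
  by move=> w; rewrite qE; apply: bword_inj; rewrite !string_mul.
exact: combination_context.
Qed.

Lemma combination_oper S f : comb S f -> comb S (oper f).
Proof.
move=> fS; have [q qE] := context_bracket Z.
rewrite -[oper f]/(malg_lift (@bracket Z) f) -(eq_malg_lift qE).
exact: combination_context.
Qed.

Lemma opIdeal_combination (I : set {malg k[{fmonom Z}]}) S (G : set {malg k[{fmonom Z}]}) f :
  (forall p, I p -> p \in ideal_gen G) ->
  f \in opIdeal_gen (S `|` incl @` I) -> comb (S `|` incl @` G) f.
Proof.
move=> IG; have comb1 s : (S `|` incl @` G) s -> comb (S `|` incl @` G) s.
  move=> Ss; have [q qE] := context_id Z.
  by rewrite -[s]malg_lift_id -(eq_malg_lift qE); apply: combination1.
apply: opIdeal_gen_min => [|x y|a x|a x|x|s [Ss|[p Ip <-]]].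
- exact: Comb0.
- exact: combinationB.
- exact: combination_mull.
- exact: combination_mulr.
- exact: combination_oper.
- by apply: comb1; left.
- move: p {Ip} (IG p Ip); apply: ideal_gen_min => [|x y Px Py|a x Px|a x Px|p Gp].
  + by rewrite raddf0; apply: Comb0.
  + by rewrite malg_lift_zmod_morphism; apply: combinationB.
  + by rewrite incl_mul; apply: combination_mull.
  + by rewrite incl_mul; apply: combination_mulr.
  + by apply: comb1; right; exists p.
Qed.

Lemma letters_eval_ideal (X : choiceType) (J : opIdealType kMZ) (r : X -> kMZ) x b
    (t : seq (letter X)) :
  count_mem (inl x) (string t) = 1%N -> b \in J -> letters_eval (update r x b) t \in J.
Proof.
move=> + bJ; elim/letters_ind: t => [//|y s IHs|v s IHv IHs].
  rewrite string_var_cons letters_eval_var [count_mem _ _]/= -[inl y == inl x]/(y == x).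
  rewrite [update r x b y]/update; case: eqP => _; first by move=> _; exact: Defs.idealMr.
  by move=> s1; apply: Defs.idealMl; apply: IHs.
rewrite count_string_br letters_eval_br.
case: (count_mem (inl x) (string v)) IHv => [|[|n]] IHv //.
  by move=> s1; apply: Defs.idealMl; apply: IHs.
by move=> _; apply: Defs.idealMr; apply: ideal_oper; apply: IHv.
Qed.

(** A word with a star is a monomial that is linear in the star, and [q|_s] is its
    value at [s]. *)
Lemma bplug_ideal (J : opIdealType kMZ) q s : s \in J -> malg_lift (bplug q) s \in J.
Proof.
move=> sJ; pose r (y : option Z) : {bword Z} :=
  if y is Some z then FMonom [:: Var z] else FMonom [::].
have q1 : count_mem (inl None) (string (val q)) = 1%N.
  by case: q => q; rewrite /= occE => /eqP.
have qE v : bplug q v = bsubst (update r None v) (val q).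
  by apply: bword_inj; rewrite !string_bsubst; congr string_subst; apply/funext => -[].
suff -> : malg_lift (bplug q) s =
    letters_eval (update (fun y => << r y >>) None s) (val q).
  exact: letters_eval_ideal.
have sE : \sum_(v <- msupp s) scal s@_v * << v >> = s.
  rewrite [RHS]monalgE; apply: eq_bigr => v _.
  by rewrite scal_malg scale_monomial mulr1.
rewrite -[s in RHS]sE.
rewrite letters_eval_sum //; apply: eq_bigr => v _.
rewrite scal_malg -[X in << X *g _ >>]mulr1 -scale_monomial; congr (_ *: _).
have -> : update (fun y => << r y >> : kMZ) None << v >> =
    fun y => << update r None v y >>.
  by apply/funext => y; rewrite /update; case: (y == None).
by rewrite letters_eval_words fmK qE.
Qed.

End Ideals.

(** * The basis of reduced words *)

Lemma quot_pi_eq0 (A : pzRingType) (I : idealType A) (x : A) :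
  quot_pi I x = 0 <-> x \in I.
Proof.
rewrite -(raddf0 (quot_pi I)); split=> [/quot_piP|xI]; first by rewrite subr0.
by apply/quot_piP; rewrite subr0.
Qed.

Lemma quot_pi_uAlg_morphism (k : fieldType) (A : uAlgType k) (I : idealType A) :
  uAlg_morphism (quot_pi I).
Proof.
split=> //; [exact: quot_pi_zmod_morphism | exact: quot_pi_monoid_morphism].
Qed.

Lemma quot_pi_uOpAlg_morphism (k : fieldType) (A : uOpAlgType k) (I : opIdealType A) :
  uOpAlg_morphism (quot_pi I).
Proof.
split=> [|x]; first exact: quot_pi_uAlg_morphism.
by rewrite [RHS]quot_operE.
Qed.

Section Basis.
Variables (k : fieldType) (Z : choiceType) (leZ : rel {bword Z}).
Local Notation kMZ := {malg k[{bword Z}]}.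
Hypothesis leZ_order : monomial_order (@bplug Z) leZ.
Variable S : set kMZ.
Hypothesis S_confluent : confluent (@bplug Z) leZ S.
Variable J : opIdealType kMZ.
Hypothesis SJ : forall s, S s -> s \in J.
Hypothesis JS : forall f, f \in J -> combination (@bplug Z) leZ S (fun=> True) f.
Local Notation irr := (Irr (@bplug Z) leZ S).
Local Notation eta := (quot_pi J : kMZ -> quotAlg J).

Definition reduced (f : kMZ) : Prop := forall w, w \in msupp f -> irr w.

Lemma reducedD f g : reduced f -> reduced g -> reduced (f + g).
Proof.
move=> fr gr w /(fsubsetP (msuppD_le _ _)); rewrite in_fsetU.
by case/orP => [/fr|/gr].
Qed.

Lemma reducedZ c f : reduced f -> reduced (c *: f).
Proof. by move=> fr w /(fsubsetP (msuppZ_le _ _)) /fr. Qed.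

Lemma reduced_sum (I : eqType) (r : seq I) (F : I -> kMZ) :
  (forall i, i \in r -> reduced (F i)) -> reduced (\sum_(i <- r) F i).
Proof.
move=> Fr; rewrite big_seq; elim/big_ind: _ => //; last exact: reducedD.
by move=> w; rewrite msupp0.
Qed.

(** By the diamond lemma, a nonzero element of the ideal has a reducible leading
    word. *)
Lemma reduced_eq0 f : reduced f -> f \in J -> f = 0.
Proof.
move=> fr fJ; apply/eqP; apply: contraT => f0.
have [_ [q [s [Ss s0 leadE]]]] := diamond leZ_order S_confluent (JS fJ) f0.
by case: (fr _ (lead_supp leZ f0)); exists s, q.
Qed.

Lemma sub_replace (f : kMZ) (F : {bword Z} -> kMZ) :
  f - \sum_(v <- msupp f) f@_v *: F v =
  \sum_(v <- msupp f) scal f@_v * (<< v >> - F v).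
Proof.
rewrite {1}[f]monalgE -sumrB; apply: eq_bigr => v _.
by rewrite scal_malg scalerBr scale_monomial mulr1.
Qed.

Lemma word_reduction w : exists2 f, reduced f & << w >> - f \in J.
Proof.
elim/(mlt_ind leZ_order): w => w IH.
have [wirr|] := pselect (irr w).
  exists << w >>; last by rewrite subrr rpred0.
  by move=> v /(fsubsetP msuppU_le); rewrite in_fset1 => /eqP ->.
move=> /contrapT[s [q [Ss s0 wE]]].
have [h hr] : {h : kMZ | h = << w >> - (s@_(lead leZ s))^-1 *: malg_lift (bplug q) s}.
  by exists (<< w >> - (s@_(lead leZ s))^-1 *: malg_lift (bplug q) s).
have sw : (malg_lift (bplug q) s)@_w = s@_(lead leZ s).
  by rewrite -(mcoeff_plug leZ_order q) -wE.
have hlt v : v \in msupp h -> leZ v w && (v != w).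
  rewrite hr => vh; have vw : leZ v w.
    move: vh => /(fsubsetP (msuppB_le _ _)); rewrite in_fsetU => /orP[].
      move=> /(fsubsetP msuppU_le); rewrite in_fset1 => /eqP ->.
      exact: mle_refl leZ_order _.
    by move=> /(fsubsetP (msuppZ_le _ _)) /(msupp_plug leZ_order); rewrite wE.
  rewrite vw; apply: contraTneq vh => ->; rewrite -mcoeff_eq0 mcoeffB mcoeffZ.
  by rewrite mcoeffUU sw mulVf ?subrr // lcoef_neq0.
have /choice[F FE] : forall v, exists f, v \in msupp h -> reduced f /\ << v >> - f \in J.
  move=> v; have [vh|] := boolP (v \in msupp h); last by exists 0.
  by have [f fr fJ] := IH v (hlt v vh); exists f.
exists (\sum_(v <- msupp h) h@_v *: F v).
  by apply: reduced_sum => v /FE[Fr _]; apply: reducedZ.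
have -> : << w >> = (s@_(lead leZ s))^-1 *: malg_lift (bplug q) s + h.
  by rewrite hr addrC subrK.
rewrite -addrA rpredD //.
  by rewrite -scal_malg; apply/Defs.idealMl/bplug_ideal/SJ.
rewrite sub_replace big_seq rpred_sum // => v /FE[_ FJ].
exact: Defs.idealMl.
Qed.

Lemma reduction f : exists2 g, reduced g & eta f = eta g.
Proof.
have /choice[F FE] : forall w, exists g, reduced g /\ << w >> - g \in J.
  by move=> w; have [g gr gJ] := word_reduction w; exists g.
exists (\sum_(w <- msupp f) f@_w *: F w).
  by apply: reduced_sum => w _; apply: reducedZ; case: (FE w).
apply/quot_piP.
rewrite sub_replace rpred_sum // => v _.
by apply: Defs.idealMl; case: (FE v).
Qed.

Lemma eta_sum (I : Type) (r : seq I) (c : I -> k) (w : I -> {bword Z}) :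
  eta (\sum_(i <- r) c i *: << w i >>) = \sum_(i <- r) scal (c i) * eta << w i >>.
Proof.
rewrite -(uAlg_morphism_sum _ _ _ (quot_pi_uAlg_morphism J)).
by congr (quot_pi _ _); apply: eq_bigr => i _; rewrite scal_malg.
Qed.

Lemma reduced_word w : irr w -> reduced << w >>.
Proof. by move=> wirr v /(fsubsetP msuppU_le); rewrite in_fset1 => /eqP ->. Qed.

Lemma eta_irr_inj v w : irr v -> irr w -> eta << v >> = eta << w >> -> v = w.
Proof.
move=> virr wirr /quot_piP vwJ; apply/eqP; apply: contraT => vNw.
have : << v >> - << w >> = 0 :> kMZ.
  apply: reduced_eq0 vwJ; rewrite -scaleN1r; apply: reducedD; last apply: reducedZ;
  exact: reduced_word.
move=> /(congr1 (mcoeff w)); rewrite mcoeffB mcoeffUU mcoeffU (negPf vNw) mcoeff0.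
by rewrite sub0r => /eqP; rewrite oppr_eq0 oner_eq0.
Qed.

Lemma irr_basis : is_basis [set eta << w >> | w in irr].
Proof.
split=> [y|s c s_uniq s_irr sum0].
  have [f fr yE] := reduction (quot_repr y); rewrite quot_reprK in yE.
  have /choice[c cE] : forall x, exists a : k, forall w, w \in msupp f ->
      eta << w >> = x -> f@_w = a.
    move=> x; have [[w [wf wx]]|no] := pselect (exists w, w \in msupp f /\ eta << w >> = x).
      exists f@_w => v vf vx; congr (_@_ _); apply: eta_irr_inj; [exact: fr|exact: fr|].
      by rewrite wx.
    by exists 0 => w wf wx; case: no; exists w.
  exists [seq eta << w >> | w : {bword Z} <- msupp f], c; split.
    by move=> x /mapP[w wf ->]; exists w => //; apply: fr.
  rewrite big_map yE {1}[f]monalgE.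
  transitivity (eta (\sum_(w <- msupp f) f@_w *: << w >>)).
    by congr (quot_pi _ _); apply: eq_bigr => w _; rewrite scale_monomial mulr1.
  by rewrite eta_sum; apply: eq_big_seq => w wf; rewrite -(cE _ w).
have /choice[h hE] : forall x, exists w, x \in s -> irr w /\ eta << w >> = x.
  move=> x; have [/s_irr[w wirr wx]|] := boolP (x \in s); first by exists w.
  by exists (FMonom [::]).
have f0 : \sum_(x <- s) c x *: << h x >> = 0 :> kMZ.
  apply: reduced_eq0.
    by apply: reduced_sum => x /hE[hirr _]; apply/reducedZ/reduced_word.
  apply/quot_pi_eq0; rewrite eta_sum -[RHS]sum0; apply: eq_big_seq => x /hE[_ hx].
  by rewrite hx.
have coefE w : (\sum_(x <- s) c x *: << h x >> : kMZ)@_w =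
    \sum_(x <- s) c x *+ (h x == w).
  rewrite raddf_sum; apply: eq_bigr => x _ /=.
  by rewrite scale_monomial mcoeffU mulr1.
move=> x xs; have := coefE (h x); rewrite f0 mcoeff0 (bigD1_seq x) //= eqxx => ->.
rewrite big_seq_cond big1 ?addr0 // => y /andP[ys yNx]; case: eqP => // hxy.
by case/eqP: yNx; rewrite -(hE y ys).2 -(hE x xs).2 hxy.
Qed.

End Basis.

(** * The free algebra over a quotient *)

Section FreeOperatedAlgebra.
Variables (k : fieldType) (Z : choiceType).
Local Notation kMZ := {malg k[{bword Z}]}.
Implicit Types (B : uOpAlgType k) (f g : kMZ).

Lemma OPI_evalU B (r : Z -> B) c w : OPI_eval << c *g w >> r = scal c * word_eval r w.
Proof. by rewrite (OPI_evalEw _ msuppU_le) big_seq_fset1 mcoeffUU. Qed.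

Lemma OPI_eval_zmod_morphism B (r : Z -> B) :
  zmod_morphism (fun f : kMZ => OPI_eval f r).
Proof.
move=> f g; pose d := (msupp f `|` msupp g)%fset.
rewrite !(@OPI_evalEw _ _ _ _ d) ?fsubsetUl ?fsubsetUr ?msuppB_le //.
rewrite -sumrB; apply: eq_bigr => m _.
by rewrite mcoeffB scal_zmod_morphism mulrBl.
Qed.

Lemma word_evalM B (r : Z -> B) (v w : {bword Z}) :
  word_eval r (mmul v w) = word_eval r v * word_eval r w.
Proof. by rewrite !word_evalE -letters_eval_cat /mmul /= fmmulE. Qed.

Lemma OPI_eval_uOpAlg_morphism B (r : Z -> B) :
  uOpAlg_morphism (fun f : kMZ => OPI_eval f r).
Proof.
have zm := OPI_eval_zmod_morphism r.
have E1 c : OPI_eval << c *g (mone : {bword Z}) >> r = scal c.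
  by rewrite OPI_evalU word_evalE fm1 mulr1.
split; first split=> //; first split=> [|f g].
- by rewrite E1 scal1.
- rewrite malgME (zmod_morphism_sum zm) [OPI_eval f r]/OPI_eval mulr_suml.
  apply: eq_bigr => v _; rewrite (zmod_morphism_sum zm) [OPI_eval g r]/OPI_eval mulr_sumr.
  apply: eq_bigr => w _; rewrite OPI_evalU word_evalM scalM.
  by rewrite -!mulrA; congr (_ * _); rewrite !mulrA scal_central.
- move=> f; rewrite -[oper f]/(malg_lift (@bracket Z) f) (zmod_morphism_sum zm).
  rewrite [OPI_eval f r]/OPI_eval (zmod_morphism_sum (@oper_zmod_morphism k B)).
  apply: eq_bigr => v _; rewrite OPI_evalU oper_scal; congr (_ * _).
  by rewrite !word_evalE letters_eval_br mulr1.
Qed.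

Lemma OPI_eval_id f : OPI_eval f (fun z => << FMonom [:: Var z] >> : kMZ) = f.
Proof.
rewrite -[LHS]/(OPI_words f (fun z => FMonom [:: Var z])) OPI_wordsE.
rewrite -[RHS]malg_lift_id; apply: eq_malg_lift => w.
apply: bword_inj; rewrite string_bsubst; elim: (string w) => // -[z|b] s IHs;
  by rewrite string_subst_cons IHs.
Qed.

Lemma eq_uOpAlg_morphism B (h h' : kMZ -> B) : uOpAlg_morphism h -> uOpAlg_morphism h' ->
  (forall z, h << FMonom [:: Var z] >> = h' << FMonom [:: Var z] >>) -> h =1 h'.
Proof.
move=> hm hm' hh' f; rewrite -[f]OPI_eval_id (OPI_eval_morph _ _ hm) (OPI_eval_morph _ _ hm').
by congr OPI_eval; apply/funext => z /=.
Qed.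

(** By multilinearity, an instance of [phi] at arbitrary elements expands into its
    instances at words, one variable at a time. *)
Lemma OPI_eval_mem (X : choiceType) (phi : {malg k[{bword X}]}) (J : opIdealType kMZ)
    (r : X -> kMZ) : multilinear_OPI phi ->
  (forall u : X -> {bword Z}, OPI_words phi u \in J) -> OPI_eval phi r \in J.
Proof.
move=> [xs [_ _ occxs]] phiJ.
suff H (ys : seq X) : forall r : X -> kMZ,
    (forall x, x \in xs -> x \notin ys -> exists m, r x = << m >>) ->
    OPI_eval phi r \in J.
  by apply: (H xs) => x xxs; rewrite xxs.
elim: ys => [|y ys IHys] {}r rys.
  have /choice[u uE] : forall x, exists m, x \in xs -> r x = << m >>.
    move=> x; have [xxs|_] := boolP (x \in xs); last by exists (FMonom [::]).
    by have [m mE] := rys x xxs isT; exists m.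
  have -> : OPI_eval phi r = OPI_words phi u; last exact: phiJ.
  apply: eq_in_OPI_eval => m x mphi xm; apply: uE.
  have := occxs m mphi x; rewrite occE; case: (x \in xs) => // /eqP.
  by rewrite eqn0Ngt -has_count has_pred1 xm.
have [yxs|yxs] := boolP (y \in xs); last first.
  apply: IHys => x xxs xys; apply: rys => //; rewrite inE negb_or xys andbT.
  by apply: contraNneq yxs => <-.
have phi1 m : m \in msupp phi -> count_mem (inl y) (string m) = 1%N.
  by move=> mphi; rewrite -occE occxs // yxs.
have rE : r = update r y (\sum_(v <- msupp (r y)) scal (r y)@_v * << v >>).
  apply/funext => x; rewrite /update; case: eqP => // ->.
  rewrite [LHS]monalgE; apply: eq_bigr => v _.
  by rewrite scal_malg scale_monomial mulr1.
rewrite rE OPI_eval_sum // rpred_sum // => v _.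
apply/Defs.idealMl/IHys => x xxs xys; rewrite /update.
have [_|xNy] := eqVneq x y; first by exists v.
by apply: rys => //; rewrite inE negb_or xNy.
Qed.

End FreeOperatedAlgebra.

Section FreePhiAlgebra.
Variables (k : fieldType) (X Z : choiceType) (Phi : set {malg k[{bword X}]}).
Hypothesis Phi_multilinear : forall phi, Phi phi -> multilinear_OPI phi.
Variable IA : idealType {malg k[{fmonom Z}]}.
Local Notation kMZ := {malg k[{bword Z}]}.
Local Notation incl := (malg_lift (@word_bword Z) : _ -> kMZ).
Local Notation J := (opIdeal_gen (OPI_instances Phi Z `|` incl @` [set p | p \in IA])).
Local Notation F := (quotAlg J).
Local Notation eta := (quot_pi J : kMZ -> F).

(** The unit of the adjunction: [incl] maps [IA] into [J]. *)
Definition unit_map (a : quotAlg IA) : F := eta (incl (quot_repr a)).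

Lemma incl_mem p : p \in IA -> incl p \in J.
Proof. by move=> pI; apply: mem_opIdeal_gen; right; exists p. Qed.

Lemma unit_mapE p : unit_map (quot_pi IA p) = eta (incl p).
Proof.
apply/quot_piP; rewrite -malg_lift_zmod_morphism; apply: incl_mem.
exact: ideal_quot_repr.
Qed.

Lemma incl_uAlg_morphism : uAlg_morphism incl.
Proof.
have inclC c : incl << c *g (mone : {fmonom Z}) >> = << c *g (mone : {bword Z}) >>.
  by rewrite malg_liftU; congr (<< _ *g _ >>); apply: bword_inj; rewrite string_word !fm1.
split; [exact: malg_lift_zmod_morphism | split; [exact: inclC | exact: incl_mul] |].
exact: inclC.
Qed.

Lemma unit_map_uAlg_morphism : uAlg_morphism unit_map.
Proof.
have [iz [i1 iM] is_] := incl_uAlg_morphism.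
have [ez [e1 eM] es] := quot_pi_uAlg_morphism J.
split; [|split|] => /=.
- by elim/quot_piW => a; elim/quot_piW => b; rewrite -raddfB !unit_mapE iz ez.
- by rewrite -[1]/(quot_pi IA 1) unit_mapE i1 e1.
- by elim/quot_piW => a; elim/quot_piW => b; rewrite -rmorphM !unit_mapE iM eM.
- move=> c; have [_ _ qs] := quot_pi_uAlg_morphism IA.
  exact: etrans (congr1 unit_map (esym (qs c)))
    (etrans (unit_mapE _) (etrans (congr1 (quot_pi J) (is_ c)) (es c))).
Qed.

Lemma quot_Phi_algebra : Phi_algebra Phi F.
Proof.
move=> phi Pphi r.
have -> : r = eta \o (fun x => quot_repr (r x)) by apply/funext => x /=; rewrite quot_reprK.
rewrite -(OPI_eval_morph _ _ (quot_pi_uOpAlg_morphism J)); apply/quot_pi_eq0.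
apply: OPI_eval_mem; first exact: Phi_multilinear.
by move=> u; apply: mem_opIdeal_gen; left; exists phi, u.
Qed.

Section Extension.
Variables (B : uOpAlgType k) (B_Phi : Phi_algebra Phi B).
Variables (f : quotAlg IA -> B) (f_morph : uAlg_morphism f).

Let ext (p : kMZ) : B := OPI_eval p (fun z => f (quot_pi IA << FMonom [:: z] >>)).

Let ext_morph : uOpAlg_morphism ext. Proof. exact: OPI_eval_uOpAlg_morphism. Qed.

Lemma ext_incl p : ext (incl p) = f (quot_pi IA p).
Proof.
have [fz [f1 fM] fs] := f_morph.
have -> : p = \sum_(v <- msupp p) scal p@_v * << v >>.
  rewrite [LHS]monalgE; apply: eq_bigr => v _.
  by rewrite [_ * _]mul_malgC scale_monomial mulr1.
rewrite (uAlg_morphism_sum _ _ _ incl_uAlg_morphism).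
rewrite (uAlg_morphism_sum _ _ _ (quot_pi_uAlg_morphism IA)).
rewrite (uAlg_morphism_sum _ _ _ ext_morph.1) (uAlg_morphism_sum _ _ _ f_morph).
apply: eq_bigr => v _; congr (_ * _); rewrite malg_liftU /ext OPI_evalU scal1 mul1r.
rewrite word_evalE -[v in RHS]fmK [fmonom_val (word_bword v)]/=.
elim: (v : seq Z) => [|z s IHs].
  rewrite -[LHS]f1; congr (f _); congr (quot_pi _ << _ >>); apply: val_inj.
  by rewrite /= fm1.
rewrite [map _ _]/= letters_eval_var IHs -fM -rmorphM malgM_def fgmulUU mulr1.
by congr (f (quot_pi _ << _ >>)); rewrite /mmul /= fmmulE.
Qed.

Lemma ext_ideal p : p \in J -> ext p = 0.
Proof.
have [[ez [e1 eM] es] eo] := ext_morph.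
have e0 : ext 0 = 0 := zmod_morphism0 ez.
apply: (opIdeal_gen_min (P := fun x => ext x = 0)) =>
  [|x y ex ey|a x ex|a x ex|x ex|s [[phi [u [Pphi ->]]]|[q qI <-]]].
- exact: e0.
- by rewrite ez ex ey subr0.
- by rewrite eM ex mulr0.
- by rewrite eM ex mul0r.
- by rewrite eo ex (zmod_morphism0 (@oper_zmod_morphism k B)).
- by rewrite /OPI_words (OPI_eval_morph _ _ ext_morph) B_Phi.
- rewrite ext_incl; have -> : quot_pi IA q = 0 by apply/quot_pi_eq0.
  by case: f_morph => fz _ _; apply: zmod_morphism0 fz.
Qed.

Lemma ext_quot : exists! h : F -> B, uOpAlg_morphism h /\ h \o unit_map = f.
Proof.
have [[ez [e1 eM] es] eo] := ext_morph.
pose h (y : F) : B := ext (quot_repr y).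
have hE p : h (eta p) = ext p.
  apply/eqP; rewrite -subr_eq0 -ez; apply/eqP; apply: ext_ideal.
  exact: ideal_quot_repr.
have [[qz [q1 qM] qs] qo] := quot_pi_uOpAlg_morphism J.
exists h; split.
  split; first split; first split; first 1 last.
  - split; first by rewrite -q1 hE e1.
    by elim/quot_piW => x; elim/quot_piW => y; rewrite -qM !hE eM.
  - by move=> c; rewrite -qs hE es.
  - by elim/quot_piW => x; rewrite -qo !hE eo.
  - by apply/funext; elim/quot_piW => p /=; rewrite unit_mapE hE ext_incl.
  - by elim/quot_piW => x; elim/quot_piW => y; rewrite -qz !hE ez.
move=> h' [[[h'z [h'1 h'M] h's] h'o] h'f]; apply/funext; elim/quot_piW => p.
rewrite hE; apply: (@eq_uOpAlg_morphism _ _ _ ext (h' \o eta)) => //.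
  split; [split; [|split|]|] => [x y||x y|c|x] /=.
  - by rewrite qz h'z.
  - by rewrite q1 h'1.
  - by rewrite qM h'M.
  - by rewrite qs h's.
  - by rewrite qo h'o.
move=> z /=; have -> : << FMonom [:: Var z] >> = incl << FMonom [:: z] >>.
  by rewrite malg_liftU.
by rewrite ext_incl -unit_mapE -h'f.
Qed.

End Extension.

Lemma unit_map_free : free_Phi_algebra_over Phi unit_map.
Proof.
split; [exact: quot_Phi_algebra | exact: unit_map_uAlg_morphism |].
by move=> B BPhi f fm; apply: ext_quot.
Qed.

End FreePhiAlgebra.

(** * The theorem *)

Theorem corollary5p10 (k : fieldType) (X Z : choiceType)
    (Phi : set {malg k[{bword X}]})
    (Phi_multilinear : forall phi, Phi phi -> multilinear_OPI phi)
    (leX : rel {bword X}) (leX_order : monomial_order (@bplug X) leX)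
    (IA : idealType {malg k[{fmonom Z}]})
    (leZ : rel {bword Z}) (leZ_order : monomial_order (@bplug Z) leZ)
    (Phi_GS : GS_basis (@bplug Z) leZ (OPI_instances Phi Z))
    (G : set {malg k[{fmonom Z}]})
    (G_GS : GS_basis_of_ideal (relpre (@word_bword Z) leZ) IA G)
    (lead_no_subword : forall phi, Phi phi ->
       forall v : {fmonom X}, (1 < breadth v)%N ->
       ~ subword (word_bword v) (lead leX phi))
    (lead_instances : forall phi, Phi phi -> forall u : X -> {bword Z},
       OPI_words phi u = 0 \/
       lead leZ (OPI_words phi u) = bsubst u (lead leX phi)) :
  let incl := malg_lift (@word_bword Z) : _ -> {malg k[{bword Z}]} in
  let F := quotAlg (opIdeal_gen
             (OPI_instances Phi Z `|` incl @` [set p | p \in IA])) in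
  let eta := @quot_pi _ _ : {malg k[{bword Z}]} -> F in
  let irr := Irr (@bplug Z) leZ (OPI_instances Phi Z `|` incl @` G) in
  (exists j : quotAlg IA -> F,
     (forall p, j (quot_pi IA p) = eta (incl p)) /\ free_Phi_algebra_over Phi j)
  /\ (forall u v, irr u -> irr v -> eta << u >> = eta << v >> -> u = v)
  /\ is_basis [set eta << w >> | w in irr].
Proof.
have [GS_G IAG] := G_GS; move=> incl F eta irr.
have conf := union_confluent Phi_multilinear leZ_order Phi_GS GS_G lead_no_subword
  lead_instances.
set J := opIdeal_gen _ in F eta *.
have SJ s : (OPI_instances Phi Z `|` incl @` G) s -> s \in J.
  case=> [Phis|[g Gg <-]]; first by apply: mem_opIdeal_gen; left.
  by apply: incl_mem; rewrite IAG; apply: mem_ideal_gen.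
have JS f : f \in J ->
    combination (@bplug Z) leZ (OPI_instances Phi Z `|` incl @` G) (fun=> True) f.
  by apply: opIdeal_combination => p /=; rewrite IAG.
split.
  exists (unit_map Phi (IA := IA)); split; first exact: unit_mapE.
  exact: unit_map_free Phi_multilinear IA.
split; first by move=> u v; apply: (eta_irr_inj leZ_order conf JS).
exact (irr_basis leZ_order conf SJ JS).
Qed.
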